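(* For each finite involutory alphabet $(A,\dagger)$, let $\mathcal{LRTT}(A,\dagger)$ be the set of languages $L\subseteq A^{+}$ that are unions of $\approx^{t}_{k}$-classes for some $k,t>0$. Then $\mathcal{LRTT}$ is an involution variety of languages, and under the Eilenberg-type correspondence between involution varieties of languages and pseudovarieties of finite involution semigroups it corresponds to the locally hermitian semidirect product of the pseudovarieties $\mathbf{Acom}^\star$ and $\mathbf{LI}^\star$.
   Context: A finite involutory alphabet $(A,\dagger)$ is a finite set with a bijection $\dagger$ satisfying $(a^\dagger)^\dagger=a$, extended to words by $(a_1\cdots a_n)^\dagger=a_n^\dagger\cdots a_1^\dagger$. For $t>0$, $i=^{t}j$ means $i=j<t$ or both $i,j\ge t$. For $w,v$ words, $\sharp^{\dagger}(w,v)$ is the number of pairs $(x,y)$ of words with $w=xvy$ or $w=xv^\dagger y$. Two words $w,w'$ are $\approx^{t}_{k}$-equivalent if $|w|<k$ and $w=w'$, or both have length at least $k$, the same prefix and the same suffix of length $k-1$, and $\sharp^{\dagger}(w,v)=^{t}\sharp^{\dagger}(w',v)$ for all nonempty $v$ of length at most $k$. Involution semigroups $(S,\star)$ satisfy $(a^\star)^\star=a$, $(ab)^\star=b^\star a^\star$. A pseudovariety of finite involution semigroups is a class closed under finite direct products, sub-$\star$-semigroups and quotients. $\mathbf{Acom}^\star$ is the class of finite involution semigroups whose underlying semigroup is aperiodic ($a^{n+1}=a^n$ for some $n$ and all $a$) and commutative; $\mathbf{LI}^\star$ those whose underlying semigroup is locally trivial ($ese=e$ for all $s$ and idempotents $e$).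 For involution semigroups $(S,\star)$ (written additively) and $(T,\diamond)$, a locally hermitian action of $T$ on $S$ is a pair of a left action $(t,s)\mapsto ts$ and right action $(s,t)\mapsto st$ (distributing over $+$ and associative in $T$) with $(ts)t'=t(st')$, $(st)^\star=t^\diamond s^\star$, and $ese^\diamond=es^\star e^\diamond$ for idempotents $e\in T$; the locally hermitian semidirect product $S\ltimes T$ is $S\times T$ with $(s_1,t_1)(s_2,t_2)=(s_1t_2+t_1s_2,t_1t_2)$ and involution $(s,t)\mapsto(s^\star,t^\diamond)$. The locally hermitian product of pseudovarieties $\mathbf{V},\mathbf{W}$ is the pseudovariety generated by all locally hermitian semidirect products $S\ltimes T$ with $S\in\mathbf{V}$, $T\in\mathbf{W}$. An involution variety of languages assigns to each finite involutory alphabet a Boolean algebra of regular languages closed under letter quotients, under $L\mapsto L^\dagger$, and under inverse images of morphisms $h:(A^+,\dagger)\to(B^+,\star)$ with $h(w^\dagger)=h(w)^\star$. The correspondence associates to a pseudovariety $\mathbf{V}$ the involution variety of languages recognised (via involution-preserving morphisms $(A^+,\dagger)\to S$ and accepting subsets) by members of $\mathbf{V}$, and conversely to an involution variety the pseudovariety generated by syntactic $\star$-semigroups of its languages. *)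

(* Defs.v *)
From HB Require Import structures.
From mathcomp Require Import all_boot.
From mathcomp Require Import classical_sets.

Set Implicit Arguments.
Unset Strict Implicit.
Unset Printing Implicit Defensive.

Local Open Scope classical_set_scope.
Local Open Scope group_scope.

HB.mixin Record hasInvolution (T : Type) := {
  dagger : T -> T;
  daggerK : involutive dagger
}.

#[short(type="involutiveType")]
HB.structure Definition Involutive := {T of hasInvolution T & Choice T}.

#[short(type="invAlphabetType")]
HB.structure Definition InvAlphabet := {A of hasInvolution A & Finite A}.

HB.mixin Record Semigroup_isStar S of Semigroup S & hasInvolution S := {
  daggerM : {morph (@dagger S) : x y / x * y >-> y * x}
}.

#[short(type="starSemigroupType")]
HB.structure Definition StarSemigroup :=
  {S of Semigroup_isStar S & Semigroup S & hasInvolution S}.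

(* Like semigroupType, this does not exclude the empty semigroup; the finite
   involutory alphabets above include the empty one.  *)
#[short(type="finStarSemigroupType")]
HB.structure Definition FinStarSemigroup := {S of StarSemigroup S & Finite S}.

Definition star_morphism (S T : starSemigroupType) (f : S -> T) : Prop :=
  {morph f : x y / x * y} /\ {morph f : x / dagger x}.

Section TrivialAndProduct.

Fact unit_mulA : associative (fun _ _ : unit => tt). Proof. by []. Qed.
HB.instance Definition _ := isSemigroup.Build unit unit_mulA.
Fact unit_daggerK : involutive (@id unit). Proof. by []. Qed.
HB.instance Definition _ := hasInvolution.Build unit unit_daggerK.
Fact unit_daggerM : {morph (@dagger unit) : x y / x * y >-> y * x}.
Proof. by []. Qed.
HB.instance Definition _ := Semigroup_isStar.Build unit unit_daggerM.

Definition prod_dagger (S T : starSemigroupType) (p : S * T) : S * T :=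
  (dagger p.1, dagger p.2).
Fact prod_daggerK (S T : starSemigroupType) : involutive (@prod_dagger S T).
Proof. by case=> s t; rewrite /prod_dagger /= !daggerK. Qed.
HB.instance Definition _ (S T : starSemigroupType) :=
  hasInvolution.Build (S * T)%type (@prod_daggerK S T).
Fact prod_daggerM (S T : starSemigroupType) :
  {morph (@dagger (S * T)%type) : x y / x * y >-> y * x}.
Proof. by move=> x y; congr pair; rewrite /= daggerM. Qed.
HB.instance Definition _ (S T : starSemigroupType) :=
  Semigroup_isStar.Build (S * T)%type (@prod_daggerM S T).
HB.instance Definition _ (S T : finStarSemigroupType) :=
  StarSemigroup.on (S * T)%type.

End TrivialAndProduct.

Definition pv_class : Type := finStarSemigroupType -> Prop.

(* Sub-star-semigroups are taken up to isomorphism, as sources of injective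
   morphisms, and quotients as targets of surjective ones.  *)
Definition pseudovariety (V : pv_class) : Prop :=
  [/\ V unit,
      forall S T : finStarSemigroupType, V S -> V T -> V (S * T)%type,
      forall (S T : finStarSemigroupType) (f : S -> T),
        star_morphism f -> injective f -> V T -> V S
    & forall (S T : finStarSemigroupType) (f : S -> T),
        star_morphism f -> (forall y, exists x, f x = y) -> V S -> V T].

Definition pv_generated (G : pv_class) : pv_class := fun S =>
  forall V : pv_class, pseudovariety V -> (forall T, G T -> V T) -> V S.

(* spow a n is the power of a with exponent n + 1.  *)
Definition spow (S : semigroupType) (a : S) (n : nat) : S := iter n (mul a) a.

Definition Acom : pv_class := fun S =>
  (exists n, forall a : S, spow a n.+1 = spow a n) /\
  commutative (@mul S).

Definition LI : pv_class := fun S =>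
  forall e s : S, e * e = e -> e * s * e = e.

(* S is the semigroup acted upon; its operation, usually written additively, is
   multiplicative here as in semigroupType, and is not assumed commutative.  *)
Record lh_action (S T : starSemigroupType) := LHAction {
  lact : T -> S -> S;
  ract : S -> T -> S;
  lactD : forall t s s', lact t (s * s') = lact t s * lact t s';
  ractD : forall s s' t, ract (s * s') t = ract s t * ract s' t;
  lactA : forall t t' s, lact t (lact t' s) = lact (t * t') s;
  ractA : forall s t t', ract (ract s t) t' = ract s (t * t');
  lractA : forall t s t', ract (lact t s) t' = lact t (ract s t');
  ract_dagger : forall s t, dagger (ract s t) = lact (dagger t) (dagger s);
  lact_hermitian : forall e s, e * e = e ->
    ract (lact e s) (dagger e) = ract (lact e (dagger s)) (dagger e)
}.

Definition sdprod (S T : starSemigroupType) (a : lh_action S T) : Type :=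
  (S * T)%type.

Section SemidirectProduct.

Variables (S T : starSemigroupType) (a : lh_action S T).

HB.instance Definition _ := Choice.on (sdprod a).

Definition sdprod_mul (p q : sdprod a) : sdprod a :=
  (ract a p.1 q.2 * lact a p.2 q.1, p.2 * q.2).

Fact sdprod_mulA : associative sdprod_mul.
Proof.
case=> [s1 t1] [s2 t2] [s3 t3]; rewrite /sdprod_mul /=.
by rewrite lactD ractD lactA ractA lractA !mulgA.
Qed.

HB.instance Definition _ := isSemigroup.Build (sdprod a) sdprod_mulA.

Definition sdprod_dagger (p : sdprod a) : sdprod a :=
  (dagger p.1, dagger p.2).

Fact sdprod_daggerK : involutive sdprod_dagger.
Proof. by case=> s t; rewrite /sdprod_dagger /= !daggerK. Qed.

HB.instance Definition _ := hasInvolution.Build (sdprod a) sdprod_daggerK.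

Fact lact_dagger t s : dagger (lact a t s) = ract a (dagger s) (dagger t).
Proof. by apply: (can_inj daggerK); rewrite ract_dagger !daggerK. Qed.

Fact sdprod_daggerM : {morph (@dagger (sdprod a)) : x y / x * y >-> y * x}.
Proof.
case=> [s1 t1] [s2 t2]; congr pair => /=; last exact: daggerM.
by rewrite daggerM ract_dagger lact_dagger.
Qed.

HB.instance Definition _ := Semigroup_isStar.Build (sdprod a) sdprod_daggerM.

End SemidirectProduct.

HB.instance Definition _ (S T : finStarSemigroupType) (a : lh_action S T) :=
  Finite.copy (sdprod a) (S * T)%type.

Definition lh_product (V W : pv_class) : pv_class :=
  pv_generated (fun P => exists (S T : finStarSemigroupType)
    (a : lh_action S T), [/\ V S, W T & P = sdprod a]).

(* word A is the free semigroup on A: nonempty words under concatenation.  *)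
Record word (A : Type) := Word { wseq :> seq A; wordP : 0 < size wseq }.

HB.instance Definition _ (A : Type) := [isSub for @wseq A].
HB.instance Definition _ (A : choiceType) := [Choice of word A by <:].

Fact in_context_subproof (A : Type) (x : seq A) (u : word A) (y : seq A) :
  0 < size (x ++ u ++ y).
Proof. by rewrite !size_cat addnCA ltn_addr // wordP. Qed.

Definition in_context (A : Type) (x : seq A) (u : word A) (y : seq A) : word A :=
  Word (in_context_subproof x u y).

Definition letter (A : Type) (a : A) : word A := @Word A [:: a] isT.

Fact word_cat_subproof (A : Type) (u v : word A) : 0 < size (u ++ v).
Proof. by rewrite size_cat ltn_addr // wordP. Qed.
Definition word_cat (A : Type) (u v : word A) : word A :=
  Word (word_cat_subproof u v).
Fact word_catA (A : choiceType) : associative (@word_cat A).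
Proof. by move=> u v w; apply: val_inj; rewrite /= catA. Qed.
HB.instance Definition _ (A : choiceType) :=
  isSemigroup.Build (word A) (@word_catA A).

Section WordDagger.

Variable A : invAlphabetType.

Fact word_dagger_subproof (u : word A) : 0 < size (rev (map dagger u)).
Proof. by rewrite size_rev size_map wordP. Qed.
Definition word_dagger (u : word A) : word A := Word (word_dagger_subproof u).
Fact word_daggerK : involutive word_dagger.
Proof.
move=> u; apply: val_inj; rewrite /= map_rev revK -map_comp.
by rewrite (eq_map (g := id)) ?map_id // => a /=; rewrite daggerK.
Qed.
HB.instance Definition _ := hasInvolution.Build (word A) word_daggerK.
Fact word_daggerM : {morph (@dagger (word A)) : x y / x * y >-> y * x}.
Proof. by move=> u v; apply: val_inj; rewrite /= map_cat rev_cat. Qed.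
HB.instance Definition _ := Semigroup_isStar.Build (word A) word_daggerM.

End WordDagger.

(* For x y with w = x v y, x is a prefix and y a suffix of w; the list
   enumerates all pairs of a prefix and a suffix of w without repetition.  *)
Definition occ (A : invAlphabetType) (w v : word A) : nat :=
  count (fun p : seq A * seq A =>
           (wseq w == p.1 ++ v ++ p.2) || (wseq w == p.1 ++ dagger v ++ p.2))
        [seq (take i w, drop j w) | i <- iota 0 (size w).+1,
                                    j <- iota 0 (size w).+1].

Definition eq_threshold (t i j : nat) : Prop :=
  (i = j /\ i < t) \/ (t <= i /\ t <= j).

Definition approx (A : invAlphabetType) (t k : nat) (w w' : word A) : Prop :=
  (size w < k /\ w = w') \/
  [/\ k <= size w, k <= size w',
      take k.-1 w = take k.-1 w',
      drop (size w - k.-1) w = drop (size w' - k.-1) w'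
    & forall v : word A, size v <= k -> eq_threshold t (occ w v) (occ w' v)].

Definition language_family : Type :=
  forall A : invAlphabetType, set (set (word A)).

(* A union of classes is given by a set X of representatives.  *)
Definition LRTT : language_family := fun A L =>
  exists t k : nat, [/\ 0 < t, 0 < k &
    exists X : set (word A), L = \bigcup_(u in X) [set w | approx t k u w]].

Definition regular (A : invAlphabetType) (L : set (word A)) : Prop :=
  exists (Q : finType) (q0 : Q) (delta : Q -> A -> Q) (F : {pred Q}),
    L = [set w | foldl delta q0 w \in F].

Record involution_variety (X : language_family) : Prop := InvolutionVariety {
  iv_regular : forall (A : invAlphabetType) L, X A L -> regular L;
  iv_set0 : forall A : invAlphabetType, X A set0;
  iv_setT : forall A : invAlphabetType, X A setT;
  iv_setU : forall (A : invAlphabetType) L K, X A L -> X A K -> X A (L `|` K);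
  iv_setI : forall (A : invAlphabetType) L K, X A L -> X A K -> X A (L `&` K);
  iv_setC : forall (A : invAlphabetType) L, X A L -> X A (~` L);
  iv_lquo : forall (A : invAlphabetType) (a : A) L,
    X A L -> X A [set w | L (letter a * w)];
  iv_rquo : forall (A : invAlphabetType) (a : A) L,
    X A L -> X A [set w | L (w * letter a)];
  iv_dagger : forall (A : invAlphabetType) L, X A L -> X A (dagger @` L);
  iv_preimage : forall (A B : invAlphabetType) (h : word A -> word B) L,
    star_morphism h -> X B L -> X A (h @^-1` L)
}.

Definition recognised_by (A : invAlphabetType) (S : starSemigroupType)
    (L : set (word A)) : Prop :=
  exists2 h : word A -> S, star_morphism h & exists P : set S, L = h @^-1` P.

Definition languages_of (V : pv_class) : language_family := fun A L =>
  exists2 S : finStarSemigroupType, V S & recognised_by S L.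

Definition syntactic_eq (A : invAlphabetType) (L : set (word A))
    (u v : word A) : Prop :=
  forall x y : seq A,
    (L (in_context x u y) <-> L (in_context x v y)) /\
    (L (in_context x (dagger u) y) <-> L (in_context x (dagger v) y)).

(* S is isomorphic to the quotient of word A by the syntactic congruence.  *)
Definition syntactic_star_semigroup (A : invAlphabetType) (L : set (word A))
    (S : starSemigroupType) : Prop :=
  exists eta : word A -> S,
    [/\ star_morphism eta, forall s, exists u, eta u = s
      & forall u v, eta u = eta v <-> syntactic_eq L u v].

Definition pv_of (X : language_family) : pv_class :=
  pv_generated (fun S => exists (A : invAlphabetType) (L : set (word A)),
    X A L /\ syntactic_star_semigroup L S).

Definition corresponds (X : language_family) (V : pv_class) : Prop :=
  (forall (A : invAlphabetType) (L : set (word A)),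
     X A L <-> languages_of V L) /\
  (forall S : finStarSemigroupType, V S <-> pv_of X S).

(* Main.v *)
(* A language recognised by a semidirect product of a commutative aperiodic S and a
   locally trivial T is threshold testable, because a product in it is a sum over
   positions of terms that only depend on a window; the hermitian condition adds
   the identity e x e^* = e x^* e^*. Conversely, let S be an aperiodic star-semigroup
   satisfying this identity in which products depend only on the ends of a word and
   the multiset of its windows. View words as trails in the graph whose vertices
   are the words of length n and whose edges are the words of length n + 1. Trails
   with the same ends and the same unoriented edge counts are related by permuting
   closed subtrails and reversing subtrails from u to u^*, both of which preserve
   the value in S; aperiodicity allows frequent closed subtrails to be added, so
   that edge counts matter only up to a threshold. In the other direction, words
   are mapped to their ends of length k together with the truncated counts of
   marked factors in all contexts of length at most k. *)

From HB Require Import structures.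
From mathcomp Require Import all_boot.
From mathcomp Require Import boolp classical_sets zify.
Require Import Defs.

Set Implicit Arguments.
Unset Strict Implicit.
Unset Printing Implicit Defensive.

(** The product pseudovariety is given by generators only, and its members are never described. Two
    bounds suffice: [reversible_lt] is a pseudovariety that contains every generator and recognises
    only languages of [LRTT], while each language of [LRTT] is recognised by one explicit generator.
    The resulting equality [LRTT = languages_of (lh_product Acom LI)] yields all closure properties
    of [LRTT], without checking them on classes of [approx]; what remains is the Eilenberg argument,
    valid for every pseudovariety. The difficulty lies in the trails. Equal truncated counts allow
    incomparable exact counts, and a bridge of the trail cannot be moved by any rearrangement. A
    bridge is crossed only once, so it never obstructs frequent edges, and what lies before it
    splits off as a closed trail. The threshold comes from a compactness argument by contradiction,
    so no explicit bound is computed. *)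

Lemma antitone_pigeonhole (X : finType) (R : nat -> X -> Prop) :
  (forall T T' x, T <= T' -> R T' x -> R T x) ->
  (forall T, exists x, R T x) -> exists x, forall T, R T x.
Proof.
move=> anti ex; apply: contrapT => nex.
have /choice[g ng] : forall x, exists T, ~ R T x.
  by move=> x; apply: contrapT => h; apply: nex; exists x => T; apply: contrapT => n; apply: h; exists T.
have [x] := ex (\max_x g x); apply/(contra_not (anti _ _ x _))/ng.
exact: leq_bigmax.
Qed.

Lemma eq_threshold_leq t t' i j : t <= t' -> eq_threshold t' i j -> eq_threshold t i j.
Proof. by rewrite /eq_threshold; lia. Qed.

(** * Trails in a finite graph with an involution on its vertices *)

Section Adjacency.
Variable T : Type.
Implicit Types p q : seq T.

Definition adj p : seq (T * T) := if p is x :: p' then pairmap pair x p' else [::].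

Lemma adj_cat p x q : adj (p ++ x :: q) = adj (rcons p x) ++ adj (x :: q).
Proof.
case: p => [|y p] //=; rewrite pairmap_cat -cats1 pairmap_cat /=.
by rewrite -catA.
Qed.

Lemma adj_catl x p q : adj (x :: p ++ q) = adj (x :: p) ++ adj (last x p :: q).
Proof. by rewrite /= pairmap_cat. Qed.

End Adjacency.

Lemma adj_map (T T' : Type) (f : T -> T') p :
  adj (map f p) = [seq (f e.1, f e.2) | e <- adj p].
Proof. by case: p => //= x p; elim: p x => //= y p IH x; rewrite IH. Qed.

Section Trails.
Variables (V : finType) (d : V -> V).
Hypothesis dK : involutive d.

Definition opp_edge (e : V * V) := (d e.2, d e.1).
(** With this disjunction an edge equal to its own opposite is counted once per traversal, just as
    [occ] counts a factor equal to its own image under [dagger]. *)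
Definition same_edge (e f : V * V) := (f == e) || (f == opp_edge e).
Definition cnt (p : seq V) (e : V * V) := count (same_edge e) (adj p).
Definition drev (p : seq V) := rev (map d p).

Lemma opp_edgeK : involutive opp_edge.
Proof. by case=> x y; rewrite /opp_edge /= !dK. Qed.

Lemma same_edge_opp e f : same_edge e (opp_edge f) = same_edge e f.
Proof.
rewrite /same_edge (inj_eq (can_inj opp_edgeK)) orbC.
by rewrite (can2_eq opp_edgeK opp_edgeK).
Qed.

Lemma same_edge_sym e f : same_edge e f = same_edge f e.
Proof.
rewrite /same_edge eq_sym; congr orb.
by rewrite [RHS]eq_sym (can2_eq opp_edgeK opp_edgeK).
Qed.

Lemma adj_map_opp p : adj (drev p) = rev (map opp_edge (adj p)).
Proof.
elim: p => [|x p IH] //; rewrite /drev /= rev_cons -/(drev p).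
case: p IH => [|y p] //= IH.
rewrite rev_cons -IH /drev /= rev_cons.
by rewrite -[rcons (rcons _ _) _]cats1 cat_rcons adj_cat cats1.
Qed.

Lemma cnt_drev p e : cnt (drev p) e = cnt p e.
Proof.
rewrite /cnt adj_map_opp count_rev count_map; apply: eq_count => f /=.
exact: same_edge_opp.
Qed.

Lemma drevK : involutive drev.
Proof.
by move=> p; rewrite /drev map_rev revK -map_comp (eq_map (g := id)) ?map_id.
Qed.

Lemma drev_cat p q : drev (p ++ q) = drev q ++ drev p.
Proof. by rewrite /drev map_cat rev_cat. Qed.

Lemma drev_cons x p : drev (x :: p) = rcons (drev p) (d x).
Proof. by rewrite /drev /= rev_cons. Qed.

Lemma adj_mem (p : seq V) (e : V * V) : e \in adj p -> e.1 \in p /\ e.2 \in p.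
Proof.
elim: p => [|x [|y p] IH] //=; rewrite [e \in _ :: _]inE => /orP[/eqP ->|/IH[]].
  by split; rewrite !inE eqxx ?orbT.
by move=> h1 h2; split; rewrite inE ?h1 ?h2 orbT.
Qed.

Lemma mem_split (x : V) s : x \in s -> exists s1 s2, s = s1 ++ x :: s2.
Proof. by case/splitPr => s1 s2; exists s1, s2. Qed.

Lemma not_uniq (s : seq V) : ~~ uniq s ->
  exists c1 x c2 c3, s = c1 ++ x :: c2 ++ x :: c3.
Proof.
elim: s => //= x s IH; rewrite negb_and negbK => /orP[/mem_split[c2 [c3 ->]]|].
  by exists [::], x, c2, c3.
by case/IH => c1 [y [c2 [c3 ->]]]; exists (x :: c1), y, c2, c3.
Qed.

Lemma adj_rcons_mem (s : seq V) y a b : (a, b) \in adj (rcons s y) -> a \in s.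
Proof.
elim: s => [|x [|x' s] IH] //=; rewrite in_cons.
  by rewrite in_nil orbF => /eqP[-> _]; rewrite mem_head.
by case/orP => [/eqP[-> _]|/IH h]; rewrite in_cons ?eqxx ?h ?orbT.
Qed.

Lemma adj_split (p : seq V) x y : (x, y) \in adj p -> exists p1 p2, p = p1 ++ x :: y :: p2.
Proof.
elim: p => [|z [|z' p] IH] //=; rewrite inE => /orP[/eqP[-> ->]|/IH[p1 [p2 E]]].
  by exists [::], p.
by exists (z :: p1), p2; rewrite E.
Qed.

Lemma cnt_cat p x q e : cnt (p ++ x :: q) e = cnt (rcons p x) e + cnt (x :: q) e.
Proof. by rewrite /cnt adj_cat count_cat. Qed.

Lemma cnt_cons x y p e : cnt (x :: y :: p) e = same_edge e (x, y) + cnt (y :: p) e.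
Proof. by []. Qed.

Lemma cnt_edge p e : 0 < cnt p e -> exists p1 p2,
  p = p1 ++ e.1 :: e.2 :: p2 \/ p = p1 ++ d e.2 :: d e.1 :: p2.
Proof.
rewrite -has_count => /hasP[[x y]] /adj_split[p1 [p2 ->]].
by case/orP => /eqP; [move: e => [? ?] [-> ->]; exists p1, p2; left
                    | case=> -> ->; exists p1, p2; right].
Qed.

(** [val] abstracts the value of the word spelled by a trail. It is a relation because a list of
    vertices need not spell a word; its instance will be [path_value]. *)
Variables (X : Type) (val : seq V -> X -> Prop).
Hypothesis val_perm : forall r p p' s, last r p = last r p' ->
  perm_eq (adj (r :: p)) (adj (r :: p')) -> val (r :: p) s -> val (r :: p') s.
Hypothesis val_rev : forall c0 r p c1 s, last r p = d r ->
  val (c0 ++ (r :: p) ++ c1) s -> val (c0 ++ drev (r :: p) ++ c1) s.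

(** Quantifying over the surrounding trail lets a tail be rearranged while the edges before it stay
    frozen. *)
Definition shuffle r p p' := [/\ last r p = last r p',
  (forall e, cnt (r :: p) e = cnt (r :: p') e) &
  forall c0 c1 s, val (c0 ++ (r :: p) ++ c1) s -> val (c0 ++ (r :: p') ++ c1) s].

Lemma shuffle_trans r p q t : shuffle r p q -> shuffle r q t -> shuffle r p t.
Proof.
move=> [l1 c1 v1] [l2 c2 v2]; split; first by rewrite l1.
  by move=> e; rewrite c1.
by move=> a b s /v1 /v2.
Qed.

Lemma shuffle_cons r b p q : shuffle b p q -> shuffle r (b :: p) (b :: q).
Proof.
move=> [l c v]; split=> //; first by move=> e; rewrite !cnt_cons c.
by move=> a a' s; have := v (rcons a r) a' s; rewrite !cat_rcons.
Qed.

Lemma shuffle_perm r p p' : last r p = last r p' ->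
  perm_eq (adj (r :: p)) (adj (r :: p')) -> shuffle r p p'.
Proof.
move=> l pe; split=> //; first by move=> e; rewrite /cnt; exact/permP.
move=> c0 c1 s; case: c0 => [|x c0].
  apply: val_perm; first by rewrite !last_cat l.
  by rewrite -!cat_cons !adj_catl l perm_cat2r.
apply: val_perm; first by rewrite /= !last_cat /= !last_cat l.
rewrite -!cat_cons !cat_cons -!(cat_cons x) !adj_cat perm_cat2l.
by rewrite !adj_catl l perm_cat2r.
Qed.

Lemma shuffle_rev r p p' q : last r p = d r -> drev (r :: p) = r :: p' ->
  shuffle r (p ++ q) (p' ++ q).
Proof.
move=> l E; have l' : last r p' = d r.
  by move: E => /(congr1 (last r)); rewrite drev_cons last_rcons.
split; first by rewrite !last_cat l l'.
  by move=> e; rewrite /cnt !adj_catl l l' !count_cat -!/(cnt _ _) -E cnt_drev.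
move=> c0 c1 s; rewrite -!cat_cons -!catA => /(val_rev l).
by rewrite E.
Qed.

Lemma shuffle_suffix r p p' c y q q' : r :: p = c ++ y :: q ->
  r :: p' = c ++ y :: q' -> shuffle y q q' -> shuffle r p p'.
Proof.
move=> E E' [l n v]; split; first by move: (congr1 (last r) E) (congr1 (last r) E'); rewrite !last_cat /= l => -> ->.
  by move=> e; rewrite E E' cnt_cat n -cnt_cat.
move=> c0 c1 s; rewrite E E' -!catA !(catA c0); exact: v.
Qed.

Definition off (s t : seq V) := forall y, y \in s -> y \notin t /\ d y \notin t.

(* The trail can be rearranged to start with the edge (r, b) unless this edge is a
   bridge leaving a closed trail through r; the rearrangements are the exchanges
   and reflections of alternating Eulerian trails. *)
Lemma shuffle_front r b p : 0 < cnt (r :: p) (r, b) ->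
  (exists p', shuffle r p (b :: p')) \/
  exists s p', [/\ r :: p = (r :: s) ++ r :: b :: p' & off (r :: s) (b :: p')].
Proof.
case/cnt_edge => /= p1 [p2 [E|E]]; last first.
  (* The edge is traversed backwards, as [d b, d r]: reversing the initial part, which runs from [r]
     to [d r], puts [(r, b)] first. *)
  left; case: p1 E => [[-> ->]|r' p1 [_ ->]].
    by rewrite dK; exists p2.
  exists (rcons (drev p1) (d r) ++ p2).
  rewrite -[p1 ++ _]/(p1 ++ [:: d b; d r] ++ p2) catA -cat_cons.
  apply: shuffle_rev; first by rewrite last_cat.
  have E2 : drev [:: d b; d r] = [:: r; b] by rewrite /drev /rev /= !dK.
  by rewrite drev_cons drev_cat E2.
case: p1 E => [[->]|r0 s [_ Ep]]; first by left; exists p2.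
case: (EM (off (r :: s) (b :: p2))) => [o|no].
  by right; exists s, p2; rewrite Ep.
left; have [y ys yt] : exists2 y, y \in r :: s & (y \in b :: p2) || (d y \in b :: p2).
  apply: contrapT => nex; apply: no => y ys.
  by case: (boolP ((y \in b :: p2) || (d y \in b :: p2))) => [h|/norP //]; case: nex; exists y.
have {}Ep : r :: p = (r :: s) ++ r :: b :: p2 by rewrite Ep.
case/splitPr: ys Ep {no} => l1 l2 Ep.
have [h hE] : exists h, rcons l1 y = r :: h.
  by case: (l1) Ep => [[<- _]|r' l1' [<- _]] //=; [exists [::] | exists (rcons l1' y)].
case/orP: yt => yt.
(* The trail reads [r .. y .. r b .. y]: its two segments from [r] to [y] are exchanged around the
   segment from [y] back to [r]. *)
- have [m1 [m2 E2]] : exists m1 m2, b :: p2 = m1 ++ y :: m2.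
    exact: mem_split yt.
  have [p' E'] : exists p', m1 ++ y :: l2 ++ l1 ++ y :: m2 = b :: p'.
    by case: m1 E2 => [|b' m1] [<- _]; eexists.
  exists p'; rewrite -E'; apply: shuffle_perm.
    have /(congr1 (last r)) /= -> := Ep.
    by rewrite E2 !last_cat /= !(last_cat, last_cons).
  have -> : adj (r :: p) = adj (rcons l1 y) ++ adj (rcons (y :: l2) r) ++
      adj (rcons (r :: m1) y) ++ adj (y :: m2).
    by rewrite Ep E2 -catA /= adj_cat -!cat_cons adj_cat -cat_cons adj_cat.
  have -> : adj (r :: m1 ++ y :: l2 ++ l1 ++ y :: m2) =
      adj (rcons (r :: m1) y) ++ adj (rcons (y :: l2) r) ++
      adj (rcons l1 y) ++ adj (y :: m2).
    rewrite -(cat_cons r m1) adj_cat; congr cat.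
    have <- : r :: (h ++ m2) = l1 ++ y :: m2 by rewrite -cat_rcons hE.
    rewrite -(cat_cons y l2) adj_cat; congr cat.
    by rewrite -cat_cons -hE cat_rcons adj_cat.
  by apply/permP => a; rewrite !count_cat; lia.
(* Here [d y] lies after the return to [r]. Reversing the segment from [y] to [d y], then the
   initial part that now runs from [r] to [d r], brings [(r, b)] to the front. *)
have [m1 [m2 E2]] : exists m1 m2, b :: p2 = m1 ++ d y :: m2.
  exact: mem_split yt.
have [p' E'] : exists p', m1 ++ d y :: drev l1 ++ drev l2 ++ d y :: m2 = b :: p'.
  by case: m1 E2 => [|b' m1] [<- _]; eexists.
exists p'; rewrite -E'.
apply: (@shuffle_trans _ _ (h ++ drev m1 ++ d r :: drev l2 ++ d y :: m2)).
  apply: (@shuffle_suffix _ _ _ l1 y (l2 ++ r :: m1 ++ d y :: m2)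
             (drev m1 ++ d r :: drev l2 ++ d y :: m2)).
  - by rewrite Ep E2 -catA.
  - by rewrite -(cat_rcons y) hE.
  - have := @shuffle_rev y (l2 ++ r :: m1 ++ [:: d y])
      (drev m1 ++ d r :: drev l2 ++ [:: d y]) m2.
    rewrite -!catA /= -!catA /=; apply.
      by rewrite last_cat /= last_cat.
    have E1 : drev [:: d y] = [:: y] by rewrite /drev /= dK.
    by rewrite drev_cons drev_cat drev_cons drev_cat E1 /= -!cats1 -!catA.
have := @shuffle_rev r (h ++ drev m1 ++ [:: d r]) (m1 ++ d y :: drev l1)
  (drev l2 ++ d y :: m2).
rewrite -!catA /=; apply; first by rewrite !last_cat.
have E1 : drev [:: d r] = [:: r] by rewrite /drev /= dK.
by rewrite -cat_cons -hE !drev_cat drevK E1 -cats1 drev_cat.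
Qed.

(** The vertex [z] forces at least one edge, so a list of loops with zero total count is empty. *)
Definition is_loop (L : seq V) := exists y z l, L = y :: z :: l /\ last z l = y.

Lemma crossing (P : pred V) b q : ~~ P b -> has P (b :: q) ->
  exists x y, [/\ (x, y) \in adj (b :: q), ~~ P x & P y].
Proof.
elim: q b => [|c q IH] b nb; first by rewrite /= (negbTE nb).
case: (boolP (P c)) => [Pc _|nc /=].
  by exists b, c; rewrite inE eqxx.
rewrite (negbTE nb) => /(IH c nc)[x [y [xy nx Py]]].
by exists x, y; rewrite inE xy orbT.
Qed.

Lemma off_pred r s t : off (r :: s) t -> exists P : pred V,
  [/\ forall x, P (d x) = P x, forall x, x \in rcons (r :: s) r -> P x &
      forall x, x \in t -> ~~ P x].
Proof.
move=> o; exists (fun x => (x \in r :: s) || (d x \in r :: s)).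
split=> [x|x|x xp]; first by rewrite dK orbC.
  by rewrite mem_rcons inE => /orP[/eqP ->|->//]; rewrite mem_head.
by apply/norP; split; apply/negP => /o[]; rewrite ?dK xp.
Qed.

Lemma cnt0 (P : pred V) p e : (forall x, x \in p -> ~~ P x) ->
  (forall x, P (d x) = P x) -> P e.1 || P e.2 -> cnt p e = 0.
Proof.
case: e => e1 e2 np Pd Pe; apply/eqP; rewrite -leqn0 leqNgt -has_count.
apply/hasP => -[[x y] /adj_mem /= [/np nx /np ny]].
case/orP => /eqP[Ex Ey]; move: Pe nx ny; rewrite Ex Ey ?Pd => /orP[]->//.
Qed.

(** The trail [q] is followed edge by edge, each edge being brought to the front of [p]. When this
    edge is a bridge of [p], the closed trail before it is split off as a loop and [q] is followed
    in what remains. *)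
Lemma dominate q r p : last r p = last r q ->
  (forall e, cnt (r :: q) e <= cnt (r :: p) e) -> exists Ls,
  [/\ forall L, L \in Ls -> is_loop L,
     forall e, cnt (r :: p) e = cnt (r :: q) e + \sum_(L <- Ls) cnt L e &
     Ls = [::] -> shuffle r p q].
Proof.
elim: q r p => [|b q IH] r p lE le.
  case: p lE {le} => [|z p] lE; first by exists [::]; split=> // e; rewrite big_nil.
  exists [:: r :: z :: p]; split=> //; last by move=> e; rewrite big_seq1.
  by move=> L; rewrite inE => /eqP ->; exists r, z, p.
have cb : 0 < cnt (r :: p) (r, b).
  by apply: leq_trans (le _); rewrite cnt_cons /same_edge eqxx.
case: (shuffle_front cb) => [[p' sh]|[s [p' [Ep o]]]].
  have [lp cp _] := sh.
  have [||Ls [isL cL sL]] := IH b p'.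
  - by rewrite -[last b q]/(last r (b :: q)) -lE lp.
  - by move=> e; have := le e; rewrite cp !cnt_cons leq_add2l.
  exists Ls; split=> //; first by move=> e; rewrite cp !cnt_cons cL addnA.
  by move/sL/(shuffle_cons r); apply: shuffle_trans.
have [P [Pd Ps np]] := off_pred o.
have cE e : cnt (r :: p) e = cnt (rcons (r :: s) r) e + (same_edge e (r, b) + cnt (b :: p') e).
  by rewrite Ep cnt_cat cnt_cons.
have ls0 e : ~~ P e.1 || ~~ P e.2 -> cnt (rcons (r :: s) r) e = 0.
  by apply: (@cnt0 (predC P)) => z /=; rewrite ?Pd // => /Ps ->.
have nq x : x \in b :: q -> ~~ P x.
  move=> xq; apply/negP => Px.
  (* An edge of [q] entering the split-off side again could occur in [p] only as the bridge itself,
     which [q] has already used. *)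
  have [|x' [y [xy nx Py]]] := @crossing P b q (np b (mem_head _ _)).
    by apply/hasP; exists x.
  have := le (x', y); rewrite cE !cnt_cons ls0 ?nx // (cnt0 np Pd) ?Py ?orbT //.
  have : 0 < cnt (b :: q) (x', y).
    by rewrite -has_count; apply/hasP; exists (x', y); rewrite // /same_edge eqxx.
  lia.
have [||Ls [isL cL sL]] := IH b p'.
- by have := congr1 (last r) Ep; rewrite /= lE last_cat /= => ->.
- move=> e; case: (posnP (cnt (b :: q) e)) => [->//|].
  rewrite -has_count => /hasP[[x y] xy se].
  have := le e; rewrite cE cnt_cons ls0 ?leq_add2l //.
  have [/nq nx /nq ny] := adj_mem xy.
  by case: e se {IH le cE} => e1 e2 /orP[]/eqP[Ex Ey]; move: nx ny; rewrite Ex Ey ?Pd => -> // ->.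
exists (rcons (r :: s) r :: Ls); split=> //.
  move=> L; rewrite inE => /orP[/eqP ->|/isL //].
  case: (s) => [|z s']; first by exists r, r, [::].
  by exists r, z, (rcons s' r); rewrite last_rcons.
by move=> e; rewrite cE cL big_cons cnt_cons; lia.
Qed.

(** A bridge is crossed exactly once by [p], whereas an edge of [z] occurs in [p] more often than in
    [z], hence at least twice. So the obstruction in [shuffle_front] never arises. *)
Lemma front_path z r p :
  (forall e, 0 < cnt (r :: z) e -> cnt (r :: z) e < cnt (r :: p) e) ->
  exists p', shuffle r p (z ++ p').
Proof.
elim: z r p => [|b z IH] r p lt; first by exists p.
have c1 : 0 < cnt (r :: b :: z) (r, b) by rewrite cnt_cons /same_edge eqxx.
have := lt _ c1; rewrite cnt_cons {1}/same_edge eqxx /= => c2.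
have c3 : 0 < cnt (r :: p) (r, b) by lia.
case: (shuffle_front c3) => [[p' sh]|[s [p' [Ep o]]]].
  have [lp cp _] := sh.
  have [|p2 sh2] := IH b p'.
    by move=> e c4; have := lt e; rewrite cp !cnt_cons; lia.
  by exists p2; apply: shuffle_trans sh (shuffle_cons _ sh2).
have [P [Pd Ps np]] := off_pred o.
move: c2; rewrite Ep cnt_cat cnt_cons (cnt0 np Pd); last first.
  by rewrite Ps // mem_rcons mem_head.
rewrite (@cnt0 (predC P) (rcons (r :: s) r)) /=; first last.
- by rewrite (np b) ?orbT // mem_head.
- by move=> x; rewrite Pd.
- by move=> x xs; rewrite /= Ps.
by rewrite /same_edge eqxx; lia.
Qed.

(** A rotation suffices when [y] is on the circuit; when [d y] is, the rotated circuit is also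
    reversed, which keeps the unoriented counts. *)
Lemma rotate_circuit u l y : (y \in u :: l) || (d y \in u :: l) -> exists m,
  size m = size l /\ forall e, cnt (rcons (y :: m) y) e = cnt (rcons (u :: l) u) e.
Proof.
have rot z : z \in u :: l -> exists m,
  size m = size l /\ forall e, cnt (rcons (z :: m) z) e = cnt (rcons (u :: l) u) e.
  case/mem_split=> l1 [l2]; case: l1 => [[<- ->]|u' l1 [_ El]].
    by exists l2.
  exists (l2 ++ u :: l1); split; first by rewrite El !size_cat /=; lia.
  move=> e; rewrite El.
  have -> : rcons (z :: l2 ++ u :: l1) z = (z :: l2) ++ u :: rcons l1 z by rewrite /= rcons_cat.
  have -> : rcons (u :: l1 ++ z :: l2) u = (u :: l1) ++ z :: rcons l2 u by rewrite /= rcons_cat.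
  by rewrite !cnt_cat addnC.
case/orP => [/rot//|/rot[m [sm cm]]].
exists (drev m); split; first by rewrite /drev size_rev size_map.
move=> e; rewrite -cm -[RHS]cnt_drev; congr cnt.
by rewrite /drev map_rcons rev_rcons /= rev_cons !dK.
Qed.

Variable N : nat.
Hypothesis val_pump : forall c0 u l c1 s,
  val (c0 ++ flatten (nseq N (u :: l)) ++ u :: c1) s ->
  val (c0 ++ flatten (nseq N.+1 (u :: l)) ++ u :: c1) s.

Lemma cnt_nseq n y m : exists z, [/\ y :: z = flatten (nseq n (y :: m)) ++ [:: y],
  last y z = y & forall e, cnt (y :: z) e = n * cnt (rcons (y :: m) y) e].
Proof.
elim: n => [|n [z [Ez lz cz]]]; first by exists [::].
exists (m ++ y :: z); split; first by rewrite /= -catA -Ez.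
  by rewrite last_cat.
by move=> e; rewrite -cat_cons cnt_cat cz mulSn.
Qed.

(** A simple circuit has at most [#|V|] edges, so [N] turns use each unoriented edge at most
    [N * #|V|] times; the successor provides the strict inequality of [front_path]. *)
Definition threshold := (N * #|V|).+1.

Lemma cnt_size p e : cnt p e <= (size p).-1.
Proof. by rewrite (leq_trans (count_size _ _)) //; case: p => //= x p; rewrite size_pairmap. Qed.

Definition extends r p p' c := [/\ last r p' = last r p,
  forall e, cnt (r :: p') e = cnt (r :: p) e + c e &
  forall s, val (r :: p) s -> val (r :: p') s].

(** A circuit with a repeated vertex splits into two shorter ones. A simple one is rotated to start
    at the first vertex [y] of the trail lying on it up to [d]; [front_path] makes the trail run [N]
    turns from [y], and [val_pump] adds one more. *)
Lemma pump_circuit u l r p :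
  (forall e, 0 < cnt (rcons (u :: l) u) e -> threshold <= cnt (r :: p) e) ->
  exists p', extends r p p' (cnt (rcons (u :: l) u)).
Proof.
have [n] := ubnP (size l); elim: n u l r p => // n IH u l r p le_n freq.
case: (boolP (uniq (u :: l))) => [uq|]; last first.
  case/not_uniq=> c1 [x [c2 [c3 E]]].
  have [l' E'] : exists l', c1 ++ x :: c3 = u :: l'.
    by case: (c1) E => [|u' c1'] [-> _]; eexists.
  have cE e : cnt (rcons (u :: l) u) e =
      cnt (rcons (x :: c2) x) e + cnt (rcons (u :: l') u) e.
    by rewrite -E' E !rcons_cat /= !rcons_cat /= !cnt_cat -(cat_cons x c2) cnt_cat /=; lia.
  have sE : size l = size c2 + size l' + 1.
    have := congr1 size E; have := congr1 size E'; rewrite /= !size_cat /= size_cat /=; lia.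
  have [||p1 [l1 n1 v1]] := IH x c2 r p; first by lia.
    by move=> e c0; apply: freq; rewrite cE; lia.
  have [||p2 [l2 n2 v2]] := IH u l' r p1; first by lia.
    by move=> e c0; rewrite n1; have := freq e; rewrite cE; lia.
  exists p2; split; first by rewrite l2.
    by move=> e; rewrite n2 n1 cE; lia.
  by move=> s /v1/v2.
have sl : (size l).+1 <= #|V| by have := max_card (mem (u :: l)); rewrite (card_uniqP uq).
pose P x := (x \in u :: l) || (d x \in u :: l).
have Pd x : P (d x) = P x by rewrite /P dK orbC.
have hP : has P (r :: p).
  apply: contraT => /hasPn np.
  have [y [l' E]] : exists y l', rcons (u :: l) u = u :: y :: l'.
    by case: (l) => [|y l']; [exists u, [::] | exists y, (rcons l' u)].
  have := freq (u, y); rewrite E cnt_cons /same_edge eqxx => /(_ isT).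
  by rewrite (cnt0 np Pd) // /P mem_head.
have [s1 [y [p1 [Ep Py ns1]]]] : exists s1 y p1, [/\ r :: p = s1 ++ y :: p1, P y & ~~ has P s1].
  by case: (split_find hP) => y s1 p1 Py ns1; exists s1, y, p1; rewrite cat_rcons.
have [m [sm cm]] := rotate_circuit Py.
have [z [Ez lz cz]] := cnt_nseq N y m.
have [|p2 sh] := @front_path z y p1.
  move=> e; rewrite cz cm => c0.
  have c1 : 0 < cnt (rcons (u :: l) u) e by move: c0; rewrite muln_gt0 => /andP[].
  have -> : cnt (y :: p1) e = cnt (r :: p) e.
    (* Before [y] the trail avoids the circuit up to [d], so it carries none of its edges. *)
    rewrite Ep cnt_cat; suff -> : cnt (rcons s1 y) e = 0 by [].
    have [P1 P2] : P e.1 /\ P e.2.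
      have Pl x : x \in rcons (u :: l) u -> P x.
        by rewrite mem_rcons in_cons => /orP[/eqP->|xl]; rewrite /P ?mem_head ?xl.
      have [q1 [q2 [Eq|Eq]]] := cnt_edge c1.
        by split; apply: Pl; rewrite Eq mem_cat !inE eqxx ?orbT.
      by rewrite -Pd -[P e.2]Pd; split; apply: Pl; rewrite Eq mem_cat !inE eqxx ?orbT.
    apply/eqP; rewrite -leqn0 leqNgt -has_count; apply/hasP => -[[a b]] /adj_rcons_mem as1.
    have nPa : ~~ P a by apply: contra ns1 => Pa; apply/hasP; exists a.
    case/orP => /eqP; first by move=> Ea; move: P1; rewrite -Ea (negbTE nPa).
    by case=> Ea _; move: nPa; rewrite Ea Pd P2.
  apply: leq_trans (freq e c1); rewrite ltnS leq_mul //.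
  by apply: leq_trans sl; rewrite (leq_trans (cnt_size _ _)) // size_rcons.
have [l1 c1 v1] := sh.
have [p' E'] : exists p', r :: p' = s1 ++ y :: m ++ y :: z ++ p2.
  by case: s1 Ep {ns1} => [[-> _]|r' s1 [<- _]]; eexists.
exists p'; split.
- have := congr1 (last r) E'; rewrite /= last_cat /= last_cat /= -l1 => ->.
  by have := congr1 (last r) Ep; rewrite /= last_cat => ->.
- move=> e; rewrite E' Ep !cnt_cat c1 -(cat_cons y m) cnt_cat -cm /=; lia.
move=> s; rewrite Ep E'; have := v1 s1 [::] s; rewrite !cats0 => h /h{h}.
have -> : s1 ++ (y :: z ++ p2) = s1 ++ flatten (nseq N (y :: m)) ++ y :: p2.
  by rewrite -(cat_cons y z) Ez -!catA.
move/val_pump; congr val; rewrite /= -!catA; congr (_ ++ _ :: _ ++ _).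
by rewrite -(cat_cons y z) Ez -!catA.
Qed.

Lemma pump_loops Ls r p : (forall L, L \in Ls -> is_loop L) ->
  (forall e, 0 < \sum_(L <- Ls) cnt L e -> threshold <= cnt (r :: p) e) ->
  exists p', extends r p p' (fun e => \sum_(L <- Ls) cnt L e).
Proof.
elim: Ls r p => [|L Ls IH] r p isL freq.
  by exists p; split=> // e; rewrite big_nil addn0.
have [y [z [l [EL lz]]]] := isL L (mem_head _ _).
have {}EL : L = rcons (y :: belast z l) y by rewrite EL (lastI z l) lz.
have [|p1 [l1 c1 v1]] := @pump_circuit y (belast z l) r p.
  by move=> e c0; apply: freq; rewrite big_cons EL; lia.
have [||p2 [l2 c2 v2]] := IH r p1.
- by move=> L' L'Ls; apply: isL; rewrite in_cons L'Ls orbT.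
- by move=> e c0; rewrite c1; have := freq e; rewrite big_cons; lia.
exists p2; split; first by rewrite l2.
  by move=> e; rewrite c2 c1 big_cons EL addnA.
by move=> s /v1/v2.
Qed.

(** The surplus of [q] over [p] is a sum of loops through frequent edges. Pumping them into [p]
    makes the counts equal; a second use of [dominate] then leaves no loop, so the pumped trail
    rearranges to [q]. *)
Lemma val_dominated r p q : last r p = last r q ->
  (forall e, cnt (r :: p) e <= cnt (r :: q) e) ->
  (forall e, cnt (r :: p) e < cnt (r :: q) e -> threshold <= cnt (r :: p) e) ->
  forall s, val (r :: p) s -> val (r :: q) s.
Proof.
move=> lE le freq s vp.
have [Ls [isL cL _]] := dominate (esym lE) le.
have [|p' [l' c' v']] := @pump_loops Ls r p isL.
  by move=> e c0; apply: freq; rewrite cL; lia.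
have [|e|Ls' [isL' cL' sh]] := @dominate q r p'; first by rewrite l'.
  by rewrite c' -cL.
have E0 : Ls' = [::].
  case: Ls' isL' cL' {sh} => // L Ls' /(_ L (mem_head _ _))[y [z [l [-> _]]]] /(_ (y, z)).
  by rewrite c' -cL big_cons cnt_cons /same_edge eqxx; lia.
by have [_ _ /(_ [::] [::] s)] := sh E0; rewrite /= !cats0; apply; apply: v'.
Qed.

Hypothesis val_fun : forall p s s', val p s -> val p s' -> s = s'.

(* Otherwise there are counterexamples p, q for every threshold. Fixing which edge
   counts stay bounded, a later q2 dominates both p and q, and differs from them
   by closed trails through frequent edges only, which can be pumped. *)
Theorem val_threshold : exists t, forall r p q s s', last r p = last r q ->
  (forall e, eq_threshold t (cnt (r :: p) e) (cnt (r :: q) e)) ->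
  val (r :: p) s -> val (r :: q) s' -> s = s'.
Proof.
apply: contrapT => nex.
pose Bad T r z p q := [/\ last r p = z, last r q = z,
  forall e, eq_threshold T (cnt (r :: p) e) (cnt (r :: q) e) &
  exists s s', [/\ val (r :: p) s, val (r :: q) s' & s <> s']].
have Bad_leq T T' r z p q : T <= T' -> Bad T' r z p q -> Bad T r z p q.
  by move=> le [lp lq c h]; split=> // e; apply: eq_threshold_leq (c e).
have [[r z] bad] : exists rz : V * V, forall T, exists p q, Bad T rz.1 rz.2 p q.
  apply: antitone_pigeonhole.
    by move=> T T' x le [p [q b]]; exists p, q; apply: Bad_leq b.
  move=> T; apply: contrapT => nb; apply: nex; exists T => r p q s s' lE c vp vq.
  apply: contrapT => ns; apply: nb; exists (r, last r p), p, q.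
  by split=> //; exists s, s'.
(* [c e = Some k] freezes the count of [e] in the first trail at [k]; [None] asks that it be at
   least [T]. *)
pose Cond (es : seq (V * V)) (c : V * V -> option nat) T p q := Bad T r z p q /\
  forall e, e \in es -> if c e is Some k then cnt (r :: p) e = k else T <= cnt (r :: p) e.
have [c cond] : exists c, forall T, exists p q, Cond (enum {: V * V}) c T p q.
  elim: (enum _) => [|e es [c IH]].
    by exists (fun=> None) => T; have [p [q b]] := bad T; exists p, q.
  have Cond_leq T T' p q : T <= T' -> Cond es c T' p q -> Cond es c T p q.
    move=> le [b h]; split=> [|e' /h]; first exact: Bad_leq b.
    by case: (c e') => // /(leq_trans le).
  have Cond_cons T p q k : Cond es c T p q ->
      (if k is Some k then cnt (r :: p) e = k else T <= cnt (r :: p) e) ->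
      Cond (e :: es) (fun e' => if e' == e then k else c e') T p q.
    move=> [b h] hk; split=> // e'; rewrite in_cons.
    by case: (eqVneq e' e) => [->|_ /= /h].
  case: (EM (forall T, exists p q, Cond es c T p q /\ T <= cnt (r :: p) e)) => [h|nh].
    exists (fun e' => if e' == e then None else c e') => T.
    by have [p [q [/Cond_cons h1 h2]]] := h T; exists p, q; apply: (h1 None).
  have [T0 hT0] : exists T0, forall p q, Cond es c T0 p q -> cnt (r :: p) e < T0.
    apply: contrapT => h; apply: nh => T; apply: contrapT => n; apply: h; exists T => p q cpq.
    by rewrite ltnNge; apply/negP => le; apply: n; exists p, q.
  have [k hk] : exists k : 'I_T0, forall T, exists p q, Cond es c T p q /\ cnt (r :: p) e = k.
    apply: antitone_pigeonhole => [T T' k le [p [q [h E]]]|T].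
      by exists p, q; split=> //; apply: Cond_leq h.
    have [p [q h]] := IH (maxn T T0).
    have lt := hT0 _ _ (Cond_leq _ _ _ _ (leq_maxr T T0) h).
    by exists (Ordinal lt), p, q; split=> //; apply: Cond_leq h; apply: leq_maxl.
  exists (fun e' => if e' == e then Some (k : nat) else c e') => T.
  by have [p [q [/Cond_cons h1 h2]]] := hk T; exists p, q; apply: (h1 (Some (k : nat))).
(* Above every frozen count, so that such a count agrees in both trails of a counterexample, and
   above [threshold], so that the other edges can be pumped. *)
pose T1 := threshold + (\max_e odflt 0 (c e)).+1.
have cT1 e k : c e = Some k -> k < T1.
  move=> ce; rewrite /T1; have := leq_bigmax (F := fun e => odflt 0 (c e)) e.
  by rewrite ce /=; lia.
have [p [q [[lp lq cpq [s [s' [vp vq ns]]]] hp]]] := cond T1.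
(* A count is bounded by the length, so the unfrozen counts of this later pair exceed all counts in
   [p] and [q]. *)
have [p2 [q2 [[lp2 lq2 cpq2 _] hp2]]] := cond (T1 + size p + size q).
have cases e : (cnt (r :: p) e = cnt (r :: q2) e /\ cnt (r :: q) e = cnt (r :: q2) e) \/
   (threshold <= cnt (r :: p) e /\ threshold <= cnt (r :: q) e /\
    cnt (r :: p) e <= cnt (r :: q2) e /\ cnt (r :: q) e <= cnt (r :: q2) e).
  have := hp e; have := hp2 e; rewrite mem_enum => /(_ isT) h2 /(_ isT) h1.
  have := cT1 e; have := cpq e; have := cpq2 e; have := cnt_size (r :: p) e.
  have := cnt_size (r :: q) e; rewrite /eq_threshold /=.
  case: (c e) h1 h2 => [k -> ->|h1 h2] s1 s2 e1 e2; first by move=> /(_ _ erefl); lia.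
  by move=> _; move: h1 h2 e1 e2; rewrite /T1; lia.
apply: ns; apply: (@val_fun (r :: q2)).
  by apply: (@val_dominated r p) vp => [|e|e]; rewrite ?lp ?lq2 //; have := cases e; lia.
by apply: (@val_dominated r q) vq => [|e|e]; rewrite ?lq ?lq2 //; have := cases e; lia.
Qed.

End Trails.

Local Open Scope group_scope.

(** * Products, windows and the class [reversible_lt] *)

Section Products.
Variable S : semigroupType.
Implicit Types (u v w : seq S).

Definition omul (a b : option S) : option S :=
  match a, b with
  | Some x, Some y => Some (x * y)
  | Some x, None => Some x
  | None, _ => b
  end.

Definition oprod w : option S := foldr (fun a => omul (Some a)) None w.

Lemma oprod_cons a w : oprod (a :: w) = omul (Some a) (oprod w). Proof. by []. Qed.

Lemma omulA : associative omul.
Proof. by case=> [x|] [y|] [z|] //=; rewrite mulgA. Qed.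

Lemma oprod_cat u v : oprod (u ++ v) = omul (oprod u) (oprod v).
Proof.
elim: u => [|a u IH]; first by case: (oprod v).
by rewrite /= IH; case: (oprod u) (oprod v) => [x|] [y|] //=; rewrite mulgA.
Qed.

Lemma oprod_Some w : 0 < size w -> exists s, oprod w = Some s.
Proof. by case: w => //= a w _; case: (oprod w) => [b|]; eexists. Qed.

Lemma oprod_nseq n (a : S) : oprod (nseq n.+1 a) = Some (spow a n).
Proof. by elim: n => //= n ->. Qed.

Lemma spow_leq m k (a : S) : m <= k -> spow a m.+1 = spow a m -> spow a k.+1 = spow a k.
Proof.
move=> le E; elim: k le => [|k IH]; first by rewrite leqn0 => /eqP <-.
rewrite leq_eqVlt => /orP[/eqP <- //|/IH Ek].
by rewrite /spow [in LHS]iterS -/(spow a _) Ek.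
Qed.

End Products.

Section ProductMorphism.
Variables (S T : semigroupType) (f : S -> T).
Hypothesis fM : {morph f : x y / x * y}.

Lemma oprod_map w : oprod (map f w) = omap f (oprod w).
Proof. by elim: w => //= a w ->; case: (oprod w) => //= b; rewrite fM. Qed.

Lemma spow_morph n a : f (spow a n) = spow (f a) n.
Proof. by elim: n => //= n IH; rewrite fM IH. Qed.
End ProductMorphism.

Section Windows.
Variable T : Type.
Implicit Types w : seq T.

Definition wins n w := [seq take n (drop i w) | i <- iota 0 ((size w).+1 - n)].

Lemma size_wins n w : size (wins n w) = (size w).+1 - n.
Proof. by rewrite size_map size_iota. Qed.

Definition suff n w := drop (size w - n) w.

End Windows.

Lemma wins_map (T T' : Type) (f : T -> T') n w : wins n (map f w) = map (map f) (wins n w).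
Proof.
rewrite /wins size_map -map_comp; apply: eq_map => i /=.
by rewrite -map_drop map_take.
Qed.

Lemma suff_map (T T' : Type) (f : T -> T') n w : suff n (map f w) = map f (suff n w).
Proof. by rewrite /suff size_map map_drop. Qed.

Definition window_invariant n (S : semigroupType) := forall w w' : seq S,
  n <= size w -> n <= size w' -> take n w = take n w' -> suff n w = suff n w' ->
  perm_eq (adj (wins n w)) (adj (wins n w')) -> oprod w = oprod w'.

(** The idempotent of the identity [e * x * dagger e = e * dagger x * dagger e] is replaced by a
    product of [n] letters: a long product contains an idempotent, and letters lift one by one along
    a quotient. *)
Definition hermitian_sandwich n (S : starSemigroupType) := forall (u : seq S) s m,
  size u = n -> oprod u = Some s -> s * m * dagger s = s * dagger m * dagger s.

(* Being a quotient does not preserve recognition of LRTT languages in an obvious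
   way: a hermitian letter need not lift to a hermitian element. The three
   properties below only involve letterwise lifts and do pass to quotients. *)
Definition reversible_lt : pv_class := fun S =>
  [/\ exists m, forall a : S, spow a m.+1 = spow a m,
      exists n0, forall n, n0 <= n -> window_invariant n S &
      exists n0, forall n, n0 <= n -> hermitian_sandwich n S].

Lemma window_invariant_morph n (S T : semigroupType) (f : S -> T) (w w' : seq S) :
  {morph f : x y / x * y} -> window_invariant n T ->
  n <= size w -> n <= size w' -> take n w = take n w' -> suff n w = suff n w' ->
  perm_eq (adj (wins n w)) (adj (wins n w')) -> omap f (oprod w) = omap f (oprod w').
Proof.
move=> fM inv sw sw' pw dw perm.
rewrite -!oprod_map //; apply: inv; rewrite ?size_map -?map_take ?suff_map ?pw ?dw //.
by rewrite !wins_map !(adj_map (map f)); apply: perm_map.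
Qed.

(** A section [g] of [f], multiplicative or not, is applied letter by letter, so equal windows lift
    to equal windows. *)
Lemma window_invariant_quo n (S T : semigroupType) (f : S -> T) :
  {morph f : x y / x * y} -> (forall y, exists x, f x = y) ->
  window_invariant n S -> window_invariant n T.
Proof.
move=> fM /choice[g gK] inv w w' sw sw' pw dw perm.
rewrite -(mapK gK w) -(mapK gK w') !(oprod_map fM); congr omap.
apply: inv; rewrite ?size_map -?map_take ?suff_map ?pw ?dw //.
by rewrite !wins_map !(adj_map (map g)); apply: perm_map.
Qed.

Lemma reversible_lt_unit : reversible_lt unit.
Proof.
have eqtt (x y : unit) : x = y by case: x; case: y.
split; first by exists 0 => x; apply: eqtt.
  exists 1%N => n n0 w w' sw sw' _ _ _.
  case: (oprod_Some (leq_trans n0 sw)) (oprod_Some (leq_trans n0 sw')) => [x ->] [y ->].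
  by rewrite (eqtt x y).
by exists 0 => n _ u s m _ _; apply: eqtt.
Qed.

Lemma reversible_lt_prod (S T : finStarSemigroupType) :
  reversible_lt S -> reversible_lt T -> reversible_lt (S * T)%type.
Proof.
move=> [[m1 a1] [n1 w1] [k1 h1]] [[m2 a2] [n2 w2] [k2 h2]].
have fstM : {morph (fst : S * T -> S) : x y / x * y} by [].
have sndM : {morph (snd : S * T -> T) : x y / x * y} by [].
split.
- exists (maxn m1 m2) => x; apply: injective_projections.
    by rewrite !(spow_morph fstM) (spow_leq (m := m1)) ?leq_maxl.
  by rewrite !(spow_morph sndM) (spow_leq (m := m2)) ?leq_maxr.
- exists (maxn n1 n2) => n; rewrite geq_max => /andP[le1 le2] w w' sw sw' pw dw perm.
  have E1 : omap fst (oprod w) = omap fst (oprod w').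
    exact: window_invariant_morph fstM (w1 n le1) sw sw' pw dw perm.
  have E2 : omap snd (oprod w) = omap snd (oprod w').
    exact: window_invariant_morph sndM (w2 n le2) sw sw' pw dw perm.
  case: (oprod w) (oprod w') E1 E2 => [[a b]|] [[a' b']|] // [->] [->].
  by [].
exists (maxn k1 k2) => n; rewrite geq_max => /andP[le1 le2] u s x su Es.
apply: injective_projections.
  apply: (h1 n le1 (map fst u)); rewrite ?size_map //.
  by rewrite (oprod_map fstM) Es.
apply: (h2 n le2 (map snd u)); rewrite ?size_map //.
by rewrite (oprod_map sndM) Es.
Qed.

Lemma reversible_lt_sub (S T : finStarSemigroupType) (f : S -> T) :
  star_morphism f -> injective f -> reversible_lt T -> reversible_lt S.
Proof.
move=> [fM fd] fI [[m a] [n w] [k h]]; split.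
- by exists m => x; apply: fI; rewrite !(spow_morph fM).
- exists n => n' /w hn u v su sv pu du perm.
  exact: (inj_omap fI (window_invariant_morph fM hn su sv pu du perm)).
exists k => n' /h hn u s x su Es; apply: fI; rewrite !fM !fd.
by apply: (hn (map f u)); rewrite ?size_map // (oprod_map fM) Es.
Qed.

Lemma reversible_lt_quo (S T : finStarSemigroupType) (f : S -> T) :
  star_morphism f -> (forall y, exists x, f x = y) -> reversible_lt S -> reversible_lt T.
Proof.
move=> [fM fd] fS [[m a] [n w] [k h]]; split.
- by exists m => x; have [y <-] := fS x; rewrite -!(spow_morph fM) a.
- by exists n => n' /w; apply: window_invariant_quo.
exists k => n' /h hn u s x su Es.
have [g gK] := choice fS; have [y <-] := fS x.
have [|t Et] := @oprod_Some S (map g u).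
  by rewrite size_map; case: (u) Es.
have -> : s = f t.
  by move: Es; rewrite -(mapK gK u) (oprod_map fM) Et => -[].
by rewrite -!fd -!fM (hn (map g u)) ?size_map.
Qed.

Lemma reversible_lt_pseudovariety : pseudovariety reversible_lt.
Proof.
split; [exact: reversible_lt_unit | exact: reversible_lt_prod |
        exact: reversible_lt_sub | exact: reversible_lt_quo].
Qed.

(** * Idempotents and locally trivial semigroups *)

Section Idempotents.
Variable S : finStarSemigroupType.
Implicit Types (a e g : S).

Lemma spowS g n : spow g n.+1 = g * spow g n. Proof. by []. Qed.

Lemma spowD g i j : spow g i * spow g j = spow g (i + j).+1.
Proof. by elim: i => // i IH; rewrite addSn [RHS]spowS -IH mulgA. Qed.

Lemma idempotent_power g : exists n, spow g n * spow g n = spow g n.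
Proof.
have [p [q [lt Epq]]] : exists p q, p < q /\ spow g p = spow g q.
  have : ~~ injectiveb (fun i : 'I_(#|S|.+1) => spow g i).
    by apply/injectiveP => /leq_card; rewrite card_ord ltnn.
  case/injectivePn => i [j ij E]; case: (ltngtP i j) => [lt|lt|/val_inj Eij].
  - by exists i, j.
  - by exists j, i.
  - by rewrite Eij eqxx in ij.
have shift n c : p <= n -> spow g (n + c * (q - p)) = spow g n.
  move=> le; elim: c => [|c <-]; first by rewrite addn0.
  have E k : spow g (k + q) = spow g (k + p).
    case: k => [|k]; first by rewrite Epq.
    by rewrite !addSn -!spowD Epq.
  have -> : n + c.+1 * (q - p) = (n - p + c * (q - p)) + q by rewrite mulSn; lia.
  by rewrite E; congr spow; lia.
(* As [spow] is shifted by one, this is the power of exponent [p.+1 * (q - p)]: a multiple of the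
   period [q - p] that exceeds [p]. *)
exists (p.+1 * (q - p)).-1; rewrite spowD.
have lt1 : p.+1 <= p.+1 * (q - p) by rewrite -[leqLHS]muln1 leq_mul // subn_gt0.
rewrite -[RHS](shift _ p.+1); last by lia.
by congr spow; lia.
Qed.

(** Among more than [#|S|] prefix products two coincide, which gives [a = a * g]; hence [a] absorbs
    every power of [g], in particular an idempotent one. *)
Lemma long_product_idempotent : exists2 m, 0 < m & forall (u : seq S) s, m <= size u ->
  oprod u = Some s -> exists a e b, e * e = e /\ s = a * e * b.
Proof.
exists #|S|.+1 => // u s su Es.
pose f i := odflt s (oprod (take i.+1 u)).
have [i [j [lt lj Eij]]] : exists i j, [/\ i < j, j < size u & f i = f j].
  have : ~~ injectiveb (fun i : 'I_(#|S|.+1) => f i).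
    by apply/injectiveP => /leq_card; rewrite card_ord ltnn.
  case/injectivePn => i [j ij E]; case: (ltngtP i j) => [lt|lt|/val_inj Eij].
  - by exists i, j; split=> //; apply: leq_trans su.
  - by exists j, i; split=> //; apply: leq_trans su.
  - by rewrite Eij eqxx in ij.
move: Eij; rewrite /f {f}.
have [a Ea] : exists a, oprod (take i.+1 u) = Some a.
  by apply: oprod_Some; rewrite size_takel //; apply: leq_trans lt _; apply: ltnW.
have [g Eg] : exists g, oprod (take (j - i) (drop i.+1 u)) = Some g.
  have sz : 0 < size (take (j - i) (drop i.+1 u)) by rewrite size_takel ?subn_gt0 // size_drop; lia.
  exact: oprod_Some sz.
have -> : take j.+1 u = take i.+1 u ++ take (j - i) (drop i.+1 u).
  by rewrite -takeD; congr take; lia.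
rewrite oprod_cat Ea Eg /= => Ead.
have Ean n : a * spow g n = a by elim: n => [|n IH] //; rewrite spowS mulgA -Ead.
have [n idem] := idempotent_power g.
move: Es; rewrite -(cat_take_drop i.+1 u) oprod_cat Ea.
case: (oprod _) => [b|] /= [<-].
  by exists a, (spow g n), b; rewrite Ean.
by exists a, (spow g n), (spow g n); rewrite !Ean.
Qed.

Lemma oprod_perm (u v : seq S) : commutative (@mul S) -> perm_eq u v -> oprod u = oprod v.
Proof.
move=> comm perm; apply: (@catCA_perm_ind _ (fun w => oprod u = oprod w) _ u v perm) => // u1 u2 u3 ->.
rewrite !oprod_cat !omulA; congr omul.
by case: (oprod u1) (oprod u2) => [x|] [y|] //=; rewrite comm.
Qed.

Lemma LI_collapse e f (x : S) : LI S -> e * e = e -> f * f = f -> e * x * f = e * f.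
Proof.
move=> li ee ff; rewrite -{1}(li e f ee).
have -> : e * f * e * x * f = e * (f * (e * x) * f) by rewrite !mulgA.
by rewrite li.
Qed.

(** Each end of length [m] contains an idempotent, and whatever stands between two idempotents can
    be erased by [LI_collapse]. *)
Lemma LI_product : LI S -> exists2 m, 0 < m & forall u : seq S, m.*2 <= size u ->
  oprod u = omul (oprod (take m u)) (oprod (suff m u)).
Proof.
move=> li; have [m m0 idem] := long_product_idempotent; exists m => // u su.
have Eu : u = take m u ++ take (size u - m.*2) (drop m u) ++ suff m u.
  rewrite -{1}(cat_take_drop m u); congr cat.
  rewrite -{1}(cat_take_drop (size u - m.*2) (drop m u)); congr cat.
  by rewrite drop_drop /suff; congr drop; lia.
have s1 : size (take m u) = m by rewrite size_take_min; lia.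
have s2 : size (suff m u) = m by rewrite size_drop; lia.
rewrite {1}Eu !oprod_cat.
have [s Es] : exists s, oprod (take m u) = Some s.
  by have h : 0 < size (take m u); [rewrite s1 | exact: oprod_Some h].
have [t Et] : exists t, oprod (suff m u) = Some t.
  by have h : 0 < size (suff m u); [rewrite s2 | exact: oprod_Some h].
have [|a [e [b [ee sE]]]] := idem _ _ _ Es; first by rewrite s1 leqnn.
have [|a' [f [b' [ff tE]]]] := idem _ _ _ Et; first by rewrite s2 leqnn.
rewrite Es Et sE tE; case: (oprod _) => [x|] //=; congr Some.
have -> : a * e * b * (x * (a' * f * b')) = a * (e * (b * x * a') * f) * b' by rewrite !mulgA.
have -> : a * e * b * (a' * f * b') = a * (e * (b * a') * f) * b' by rewrite !mulgA.
by rewrite !(LI_collapse _ li ee ff).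
Qed.
End Idempotents.

(** * Semidirect products belong to [reversible_lt] *)

Section Semidirect.
Variables (S T : finStarSemigroupType) (a : lh_action S T).
Hypotheses (comm : commutative (@mul S)) (li : LI T).

Definition olact (o : option T) s := if o is Some t then lact a t s else s.
Definition oract (o : option T) s := if o is Some t then ract a s t else s.

Lemma olact_omul o o' s : olact (omul o o') s = olact o (olact o' s).
Proof. by case: o o' => [t|] [t'|] //=; rewrite lactA. Qed.

Variable p0 : sdprod a.

(** In additive notation, the first component of a product of pairs is the sum over i of t_1 ..
    t_(i-1) s_i t_(i+1) .. t_l. At the two ends of the word an empty product acts trivially. *)
Definition summand (w : seq (sdprod a)) i : S :=
  olact (oprod (map snd (take i w)))
    (oract (oprod (map snd (drop i.+1 w))) (nth p0 w i).1).

Lemma oprod_sdprod w x : oprod w = Some x ->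
  oprod [seq summand w i | i <- iota 0 (size w)] = Some x.1 /\
  oprod (map snd w) = Some x.2.
Proof.
elim: w x => // p w IH x Ex.
have -> : [seq summand (p :: w) i | i <- iota 0 (size (p :: w))] =
    oract (oprod (map snd w)) p.1 :: [seq lact a p.2 s | s <- [seq summand w i | i <- iota 0 (size w)]].
  rewrite /=; congr cons; first by rewrite /summand /= drop0.
  rewrite (iotaDl 1 0) -!map_comp.
  apply: eq_map => i /=; rewrite /summand /=.
  by rewrite (olact_omul (Some p.2)).
case: w IH Ex => [_ [<-] //|q w IH].
have [y Ey] := oprod_Some (isT : 0 < size (q :: w)).
rewrite oprod_cons Ey => -[<-]; have [E1 E2] := IH _ Ey.
split; last by rewrite map_cons oprod_cons E2.
by rewrite E2 oprod_cons (oprod_map (lactD a p.2)) E1.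
Qed.

(** For [e = (s, E)], idempotency gives s = s E + E s. Substituted in the outer summands, this
    isolates two terms [A X] and [B X], which the hermitian condition exchanges when [X] is replaced
    by [dagger X]; commutativity then restores the sum. *)
Lemma sandwich_idempotent (e x : sdprod a) : e * e = e ->
  e * x * dagger e = e * dagger x * dagger e.
Proof.
case: e x => [s E] [x X] [Es EE]; have dEE : dagger E * dagger E = dagger E by rewrite -daggerM EE.
have TE Y : E * Y * dagger E = E * dagger E by apply: LI_collapse.
have herm z : ract a (lact a E z) (dagger E) = ract a (lact a E (dagger z)) (dagger E).
  exact: lact_hermitian.
have Es1 : s = ract a s E * lact a E s by case: Es.
have Es2 : dagger s = ract a (dagger s) (dagger E) * lact a (dagger E) (dagger s).
  by rewrite {1}Es1 daggerM ract_dagger lact_dagger.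
pose A Y := ract a (lact a E (ract a s Y)) (dagger E).
pose B Y := ract a (lact a E (lact a Y (dagger s))) (dagger E).
have AB Y : A Y = B (dagger Y) by rewrite /A herm ract_dagger.
have norm (y : S) (Y : T) :
    ((s, E) : sdprod a) * ((y, Y) : sdprod a) * dagger ((s, E) : sdprod a) =
    (ract a s (E * dagger E) * A Y * ract a (lact a E y) (dagger E) *
     (B Y * lact a (E * dagger E) (dagger s)), E * dagger E).
  congr pair; last exact: TE.
  rewrite /= ractD; congr (_ * _ * _).
    by rewrite {1}Es1 !ractD /A -lractA !ractA mulgA TE.
  by rewrite {1}Es2 lactD /B !lactA lractA TE.
have dx : dagger ((x, X) : sdprod a) = (dagger x, dagger X) by [].
rewrite dx !norm; congr pair.
rewrite -(herm x) AB (AB (dagger X)) daggerK.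
set K := ract a s _; set D := lact a _ (dagger s); set C := ract a _ _.
rewrite -!mulgA; congr (K * _).
have cA (p q r : S) : p * (q * r) = q * (p * r) by rewrite !mulgA (comm p).
by rewrite (cA C (B X)) (cA C); exact: cA.
Qed.

Lemma adj_wins (U : Type) n (w : seq U) : n <= size w -> adj (wins n w) =
  [seq (take n (drop i w), take n (drop i.+1 w)) | i <- iota 0 (size w - n)].
Proof.
move=> le; rewrite /wins subSn // (adj_map (fun i => take n (drop i w))).
have -> k N : adj (iota k N.+1) = [seq (i, i.+1) | i <- iota k N].
  by elim: N k => // N IH k; rewrite /= -IH.
by rewrite -map_comp.
Qed.

Lemma take_drop_take (U : Type) i j k (w : seq U) : i + j <= k ->
  take i (drop j (take k w)) = take i (drop j w).
Proof. by move=> le; rewrite !take_drop take_takel. Qed.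

Lemma suff_take (U : Type) i k (w : seq U) : i <= k -> k <= size w ->
  suff i (take k w) = take i (drop (k - i) w).
Proof. by move=> le1 le2; rewrite /suff size_takel // take_drop subnKC. Qed.

Section SummandLists.
Variable m : nat.
Hypotheses (m0 : 0 < m) (mT : forall u : seq T, m.*2 <= size u ->
  oprod u = omul (oprod (take m u)) (oprod (suff m u))).

Variable n : nat.
Hypothesis n4 : 4 * m <= n.

Let proj (w : seq (sdprod a)) : option T := oprod (map snd w).

(** The summand's own letter has index [m.*2] in the window [y]. Both acting products are determined
    by the [m] letters next to it and by the ends [L] and [R] of the whole word; [4 * m <= n] leaves
    at least [m.*2] letters on its right. *)
Definition central (L R : option T) (y : seq (sdprod a)) : S :=
  olact (omul L (proj (take m (drop m y))))
    (oract (omul (proj (take m (drop m.*2.+1 y))) R) (nth p0 y m.*2).1).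

Lemma proj_split w : m.*2 <= size w -> proj w = omul (proj (take m w)) (proj (suff m w)).
Proof. by move=> le; rewrite /proj map_take -suff_map -mT // size_map. Qed.

(* Away from the two ends of w, local triviality of T makes a summand depend only
   on the window around its position and on the two ends of w. *)
Lemma summands_split w : n <= size w ->
  [seq summand w i | i <- iota 0 (size w)] =
  [seq olact (proj (take i (take n w)))
     (oract (omul (proj (take m (drop i.+1 (take n w)))) (proj (suff m (suff n w))))
       (nth p0 (take n w) i).1) | i <- iota 0 m.*2] ++
  [seq central (proj (take m (take n w))) (proj (suff m (suff n w))) e.1 | e <- adj (wins n w)] ++
  [seq olact (omul (proj (take m (take n w))) (proj (take m (drop (i - m) (suff n w)))))
     (oract (proj (drop i.+1 (suff n w))) (nth p0 (suff n w) i).1) | i <- iota m.*2 (n - m.*2)].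
Proof.
move=> sw.
have sm : suff m (suff n w) = suff m w by rewrite /suff drop_drop size_drop; congr drop; lia.
have tm : take m (take n w) = take m w by rewrite take_takel //; lia.
(* The first [m.*2] positions are handled inside the prefix of length [n], the last [n - m.*2]
   inside the suffix; each other position belongs to the window starting [m.*2] letters earlier. *)
have -> : iota 0 (size w) = iota 0 m.*2 ++ iota (m.*2 + 0) (size w - n) ++
    iota (size w - n + m.*2) (n - m.*2).
  by rewrite addn0 addnC -iotaD -{1}[m.*2]add0n -iotaD; congr iota; lia.
rewrite !map_cat sm tm adj_wins // !iotaDl -!map_comp.
congr (_ ++ _ ++ _); apply/eq_in_map => i /=; rewrite mem_iota => /andP[i0 i1]; rewrite /summand.
- rewrite take_takel; last by lia.
  congr olact; congr oract.
    rewrite -/(proj (drop i.+1 w)) proj_split ?size_drop; last by lia.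
    congr omul; last by rewrite /suff drop_drop size_drop; congr (proj (drop _ _)); lia.
    by rewrite take_drop_take //; lia.
  by rewrite nth_take //; lia.
- rewrite -!/(proj _) proj_split ?size_takel; [|lia|lia].
  congr olact.
    congr omul; first by rewrite take_takel //; lia.
    rewrite suff_take; [|lia|lia].
    rewrite take_drop_take; last by lia.
    by rewrite drop_drop; congr (proj (take _ (drop _ _))); lia.
  congr oract.
    rewrite proj_split ?size_drop; last by lia.
    congr omul; last by rewrite /suff drop_drop size_drop; congr (proj (drop _ _)); lia.
    rewrite take_drop_take; last by lia.
    by rewrite drop_drop; congr (proj (take _ (drop _ _))); lia.
  by rewrite nth_take ?nth_drop; [congr (nth _ _ _).1; lia | lia].
rewrite -!/(proj _) proj_split ?size_takel; [|lia|lia].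
congr olact.
  congr omul; first by rewrite take_takel //; lia.
  rewrite suff_take; [|lia|lia].
  by rewrite drop_drop; congr (proj (take _ (drop _ _))); lia.
by rewrite /suff drop_drop nth_drop; congr oract; congr (proj (drop _ _)); lia.
Qed.

Lemma oprod_sdprod_eq (w w' : seq (sdprod a)) x y : oprod w = Some x -> oprod w' = Some y ->
  oprod [seq summand w i | i <- iota 0 (size w)] =
  oprod [seq summand w' i | i <- iota 0 (size w')] -> proj w = proj w' -> x = y.
Proof.
move=> /oprod_sdprod[E1 E2] /oprod_sdprod[E3 E4]; rewrite E1 E3 /proj E2 E4.
by case: x y {E1 E2 E3 E4} => [? ?] [? ?] [->] [->].
Qed.

Lemma proj_take_suff w : n <= size w ->
  proj w = omul (proj (take m (take n w))) (proj (suff m (suff n w))).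
Proof.
move=> le; rewrite proj_split; last by lia.
rewrite take_takel; last by lia.
by congr omul; rewrite /suff drop_drop size_drop; congr (proj (drop _ _)); lia.
Qed.

Lemma sdprod_windows (w w' : seq (sdprod a)) x y : n <= size w -> n <= size w' ->
  take n w = take n w' -> suff n w = suff n w' ->
  perm_eq (adj (wins n w)) (adj (wins n w')) ->
  oprod w = Some x -> oprod w' = Some y -> x = y.
Proof.
move=> sw sw' pw dw perm Ex Ey; apply: (oprod_sdprod_eq Ex Ey).
  rewrite !summands_split // pw dw; apply: oprod_perm => //.
  by rewrite perm_cat2l perm_cat2r; apply: perm_map.
by rewrite (proj_take_suff sw) (proj_take_suff sw') pw dw.
Qed.

(** All windows of a power of [p0] coincide, so the middle summands form a power of one element of
    [S]; from length [n + k + 1] on there are at least [k + 1] of them. *)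
Lemma sdprod_aperiodic k : (forall c : S, spow c k.+1 = spow c k) ->
  spow p0 (n + k).+1 = spow p0 (n + k).
Proof.
move=> ap; set N := n + k.
have E1 := oprod_nseq N.+1 p0; have E2 := oprod_nseq N p0.
have tk j i : j <= i -> take j (nseq i p0) = nseq j p0.
  by move=> le; rewrite -(subnKC le) nseqD take_size_cat ?size_nseq.
have sk j i : j <= i -> suff j (nseq i p0) = nseq j p0.
  by move=> le; rewrite /suff size_nseq drop_nseq; congr nseq; lia.
have aw i : n <= i -> adj (wins n (nseq i p0)) = nseq (i - n) (nseq n p0, nseq n p0).
  move=> le; rewrite adj_wins ?size_nseq //.
  apply: (@eq_from_nth _ (nseq n p0, nseq n p0)) => [|j]; rewrite size_map size_iota.
    by rewrite size_nseq.
  move=> lt; rewrite (nth_map 0%N) ?size_iota // nth_iota // nth_nseq lt add0n.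
  by rewrite !drop_nseq !tk //; lia.
have nN1 : n <= N.+1 by rewrite leqW // leq_addr.
have nN2 : n <= N.+2 := leqW nN1.
move: E1 E2; set w1 := nseq N.+2 p0; set w2 := nseq N.+1 p0 => E1 E2.
have s1 : n <= size w1 by rewrite size_nseq.
have s2 : n <= size w2 by rewrite size_nseq.
have t12 : take n w1 = take n w2 by rewrite (tk _ _ nN1) (tk _ _ nN2).
have f12 : suff n w1 = suff n w2 by rewrite (sk _ _ nN1) (sk _ _ nN2).
apply: (oprod_sdprod_eq E1 E2); last first.
  by rewrite (proj_take_suff s1) (proj_take_suff s2) t12 f12.
rewrite (summands_split s1) (summands_split s2) t12 f12 (aw _ nN1) (aw _ nN2).
rewrite !map_nseq !oprod_cat; congr (omul _ (omul _ _)).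
have -> : N.+2 - n = k.+2 by rewrite /N; lia.
have -> : N.+1 - n = k.+1 by rewrite /N; lia.
by rewrite !oprod_nseq ap.
Qed.

End SummandLists.

End Semidirect.

Lemma reversible_lt_sdprod (S T : finStarSemigroupType) (a : lh_action S T) :
  Acom S -> LI T -> reversible_lt (sdprod a).
Proof.
move=> [[k ap] comm] li; have [m m0 mT] := LI_product li; split.
- by exists (4 * m + k)%N => p0; apply: (sdprod_aperiodic p0 m0 mT (leqnn _) ap).
- exists (4 * m)%N => n n4 w w' sw sw' pw dw perm.
  have n0 : 0 < n by apply: leq_trans n4; rewrite muln_gt0.
  have w0 := leq_trans n0 sw; have w0' := leq_trans n0 sw'.
  have [x Ex] := oprod_Some w0; have [y Ey] := oprod_Some w0'.
  rewrite Ex Ey; congr Some.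
  case: w sw pw dw perm Ex {w0} => [|p0 w]; first by rewrite leqNgt n0.
  by move=> sw pw dw perm Ex; apply: (sdprod_windows comm p0 m0 mT n4 sw sw' pw dw perm Ex Ey).
have [m' m0' idem] := long_product_idempotent (sdprod a); exists m' => n le u s x su Es.
have [|b [e [c [ee ->]]]] := idem u s _ Es; first by rewrite su.
rewrite !daggerM.
(* In [b * e * c] the factor [c] is moved to the middle: [c * y * dagger c] is what the idempotent
   [e] encloses, and [dagger] turns it into [c * dagger y * dagger c]. *)
have E y : b * e * c * y * (dagger c * (dagger e * dagger b)) =
  b * (e * (c * y * dagger c) * dagger e) * dagger b by rewrite !mulgA.
by rewrite !E (sandwich_idempotent comm li _ ee) !daggerM daggerK !mulgA.
Qed.

(** * Occurrences and the correspondence between words and their lists of windows *)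

Lemma occE (A : invAlphabetType) (w v : word A) : occ w v =
  count (fun i => (take (size v) (drop i w) == v) || (take (size v) (drop i w) == dagger v))
        (iota 0 (size w).+1).
Proof.
rewrite /occ count_flatten -sumn_count -map_comp; congr sumn.
apply/eq_in_map => i; rewrite mem_iota ltnS => /andP[_ iw].
rewrite [LHS]/comp count_map; set b : bool := _ || _.
have sv : size (dagger v) = size v by rewrite size_rev size_map.
(* The length [i] of the prefix determines the factorisation: only [j = i + size v] can match. *)
have split_eq (x : seq A) j : size x = size v -> j <= size w ->
    (wseq w == take i w ++ x ++ drop j w) = (j == i + size v) && (take (size v) (drop i w) == x).
  move=> sx jw; rewrite -{1}[wseq w](cat_take_drop i) eqseq_cat // eqxx /=.
  apply/eqP/andP => [E|[/eqP -> /eqP <-]].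
    have := congr1 size E; rewrite size_cat !size_drop sx => sE.
    split; last by rewrite E take_size_cat.
    by apply/eqP; move: iw jw sE; move: (size w) (size v) => a b'; lia.
  by rewrite (addnC i) -drop_drop !cat_take_drop.
rewrite (@eq_in_count _ _ (fun j => (j == i + size v) && b)); last first.
  move=> j; rewrite mem_iota ltnS => /andP[_ jw] /=.
  by rewrite !split_eq // -andb_orr.
case Eb : b; last by rewrite (@eq_count _ _ pred0) ?count_pred0 // => j; rewrite /= andbF.
rewrite (@eq_count _ _ (pred1 (i + size v))) => [|j]; last by rewrite /= andbT.
rewrite count_uniq_mem ?iota_uniq // mem_iota ltnS /=.
have st : size (take (size v) (drop i w)) = size v.
  by move: Eb; rewrite /b => /orP[]/eqP ->; rewrite ?sv.
suff -> : (i + size v <= size w) = true by [].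
apply/idP; move: st (wordP v); rewrite size_take_min size_drop.
by move: iw; move: (size w) (size v) => a b'; lia.
Qed.

Lemma cat_inj (T : Type) (s1 s2 t1 t2 : seq T) :
  size s1 = size s2 -> s1 ++ t1 = s2 ++ t2 -> s1 = s2 /\ t1 = t2.
Proof.
move=> sE E; split; first by rewrite -(take_size_cat t1 (erefl (size s1))) E take_size_cat.
by rewrite -(drop_size_cat t1 (erefl (size s1))) E drop_size_cat.
Qed.

Lemma flatten_nseqS (T : Type) N (s : seq T) :
  flatten (nseq N.+1 s) = s ++ flatten (nseq N s).
Proof. by []. Qed.

Section WindowWords.
Variables (T : Type) (n : nat).
Hypothesis n0 : 0 < n.
Implicit Types w x y c : seq T.

Lemma wins_cons b w : n <= size w -> wins n (b :: w) = take n (b :: w) :: wins n w.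
Proof.
move=> le; rewrite /wins /= subSn ?(leqW le) //=; congr cons.
by rewrite (iotaDl 1 0) -map_comp.
Qed.

Lemma wins_self w : size w = n -> wins n w = [:: w].
Proof. by move=> E; rewrite /wins E subSnn /= drop0 -E take_size. Qed.

Lemma drop_wins i w : wins n (drop i w) = drop i (wins n w).
Proof.
rewrite /wins -map_drop drop_iota size_drop.
have -> : (size w).+1 - n - i = (size w - i).+1 - n by lia.
have iE k : iota i k = map (addn i) (iota 0 k) by rewrite -iotaDl addn0.
rewrite add0n iE -map_comp.
by apply: eq_map => j /=; rewrite drop_drop; congr (take _ (drop _ _)); lia.
Qed.

Lemma wins_inj w w' : n <= size w -> n <= size w' -> wins n w = wins n w' -> w = w'.
Proof.
elim: w w' => [|b w IH] [|b' w'] //=; try lia.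
move=> le le' E; have := congr1 size E; rewrite !size_wins /= => sE.
move: le; rewrite leq_eqVlt => /orP[/eqP sw|sw].
  have sw' : size (b' :: w') = n by rewrite /=; lia.
  by move: E; rewrite (wins_self (w := b :: w)) ?(wins_self sw') // => -[-> ->].
move: E; rewrite !wins_cons; try lia.
case=> Eh /IH ->; try lia.
by move: Eh; case: (n) n0 => // m _ [->].
Qed.

Lemma take_wins w : n <= size w -> exists q, wins n w = take n w :: q.
Proof. by move=> le; rewrite /wins subSn //= drop0; eexists. Qed.

Lemma last_wins z w : n <= size w -> last z (wins n w) = suff n w.
Proof.
move=> le; rewrite /wins subSn // -addn1 iotaD map_cat last_cat /=.
by rewrite take_oversize // size_drop; lia.
Qed.

Lemma wins_catr x y : n <= size y ->
  wins n (x ++ y) = take (size x) (wins n (x ++ take n y)) ++ wins n y.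
Proof.
move=> le; elim: x => [|b x IH]; first by rewrite take0.
have E : take n (b :: x ++ y) = take n (b :: x ++ take n y).
  by rewrite -!cat_cons !take_cat take_takel //; lia.
have s1 : n <= size (x ++ y) by rewrite size_cat; lia.
have s2 : n <= size (x ++ take n y) by rewrite size_cat size_takel //; lia.
by rewrite !cat_cons (wins_cons _ s1) (wins_cons _ s2) IH E.
Qed.

Lemma wins_catl x y : n <= size x -> wins n (x ++ y) = wins n x ++ behead (wins n (suff n x ++ y)).
Proof.
elim: x => [|b x IH] le; first by move: le => /=; lia.
move: le; rewrite leq_eqVlt => /orP[/eqP sw|sw].
  rewrite (wins_self (esym sw)) /suff -sw subnn drop0.
  have [|q E] := @take_wins ((b :: x) ++ y); first by rewrite size_cat -sw; lia.
  rewrite E /=; congr cons; rewrite -cat_cons sw; exact: take_size_cat.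
have {}sw : n <= size x by [].
have s1 : n <= size (x ++ y) by rewrite size_cat; lia.
rewrite cat_cons (wins_cons _ s1) (wins_cons _ sw) IH // /suff /= subSn //=; congr cons.
by rewrite -cat_cons takel_cat //= leqW.
Qed.

Lemma take_suff_inj w w' : size w = size w' -> size w <= n.*2 ->
  take n w = take n w' -> suff n w = suff n w' -> w = w'.
Proof.
move=> sE le tE sfE; rewrite -(cat_take_drop n w) -(cat_take_drop n w') tE; congr cat.
case: (leqP n (size w)) => lw; last by rewrite !drop_oversize //; lia.
have dE x : size x = size w -> drop n x = drop (n - (size w - n)) (suff n x).
  by move=> sx; rewrite /suff drop_drop sx; congr drop; lia.
by rewrite !dE // sfE.
Qed.

End WindowWords.

Section WindowRebuild.
Variables (T : eqType) (n : nat).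
Hypothesis n0 : 0 < n.

(** Overlapping is a condition on single edges, so every trail made of the edges of a word is again
    spelled by a word. *)
Lemma wins_rebuild (y : seq T) q : size y = n ->
  (forall e, e \in adj (y :: q) -> size e.2 = n /\ behead e.1 = take n.-1 e.2) ->
  exists2 w, n <= size w & wins n w = y :: q.
Proof.
elim: q y => [|z q IH] y sy h; first by exists y; rewrite ?sy // wins_self.
have [/= sz E] := h (y, z) (mem_head _ _).
have [|w sw wE] := IH z sz; first by move=> e ein; apply: h; rewrite in_cons ein orbT.
case: y sy h E => [|b y] sy h E; first by move: sy => /=; lia.
exists (b :: w); first by rewrite /= leqW.
rewrite wins_cons // wE; congr cons.
have [q' E'] := take_wins sw; move: E'; rewrite wE => -[zE _].
by move: E; rewrite /= zE => ->; case: (n) n0 => // m _; rewrite /= take_takel.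
Qed.

Lemma adj_wins_overlap (w : seq T) e : n <= size w -> e \in adj (wins n w) ->
  size e.2 = n /\ behead e.1 = take n.-1 e.2.
Proof.
move=> sw; rewrite adj_wins // => /mapP[i]; rewrite mem_iota => /andP[_ lt] ->.
have si : n <= size (drop i.+1 w) by rewrite size_drop; lia.
rewrite size_takel //=; split=> //.
rewrite take_takel; last by lia.
have -> : drop i.+1 w = behead (drop i w) by rewrite -drop1 drop_drop.
by case: (drop i w) (n) n0 => [|b d] [].
Qed.

End WindowRebuild.

(** * Languages recognised by members of [reversible_lt] are threshold testable *)

Section Recognition.
Variables (A : invAlphabetType) (S : finStarSemigroupType) (h : word A -> S).
Hypothesis hmor : star_morphism h.
Variables (n k : nat).
Hypotheses (n0 : 0 < n) (winv : window_invariant n S) (herm : hermitian_sandwich n S)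
  (ap : forall a : S, spow a k.+1 = spow a k).

Definition hprod (w : seq A) : option S := oprod (map (fun a => h (letter a)) w).

Lemma hprod_word (w : seq A) (w0 : 0 < size w) : hprod w = Some (h (Word w0)).
Proof.
have [hM _] := hmor; elim: w w0 => // a [|b w] IH w0.
  by congr (Some (h _)); apply: val_inj.
rewrite /hprod map_cons oprod_cons -/(hprod (b :: w)) (IH isT) /= -hM.
by congr (Some (h _)); apply: val_inj.
Qed.

Definition rdag (w : seq A) := rev (map dagger w).

Lemma rdagK : involutive rdag.
Proof. by move=> w; rewrite /rdag map_rev revK -map_comp map_id_in // => a _ /=; rewrite daggerK. Qed.

Lemma size_rdag w : size (rdag w) = size w. Proof. by rewrite size_rev size_map. Qed.

Lemma hprod_rdag w s : hprod w = Some s -> hprod (rdag w) = Some (dagger s).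
Proof.
case: (posnP (size w)) => [/size0nil -> //|w0].
have w0' : 0 < size (rdag w) by rewrite size_rdag.
have [_ hd] := hmor; rewrite !hprod_word => -[<-]; rewrite -hd.
by congr (Some (h _)); apply: val_inj.
Qed.

Lemma hprod_cat u v : hprod (u ++ v) = omul (hprod u) (hprod v).
Proof. by rewrite /hprod map_cat oprod_cat. Qed.

Lemma take_rdag i w : take i (rdag w) = rdag (suff i w).
Proof. by rewrite /rdag take_rev size_map map_drop. Qed.

Lemma suff_rdag i w : suff i (rdag w) = rdag (take i w).
Proof. by rewrite -[RHS]rdagK -[w in RHS]rdagK -[suff _ _]rdagK -take_rdag !rdagK. Qed.

Lemma wins_rdag w : n <= size w -> wins n (rdag w) = rev (map rdag (wins n w)).
Proof.
elim: w => [|b w IH] le; first by move: le => /=; lia.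
move: (le); rewrite leq_eqVlt => /orP[/eqP sw|sw].
  by rewrite !wins_self ?size_rdag.
have {}sw : n <= size w by [].
have -> : rdag (b :: w) = rdag w ++ [:: dagger b] by rewrite /rdag /= rev_cons cats1.
rewrite (wins_catl n0) ?size_rdag // IH // wins_cons // rev_cons -cats1 suff_rdag; congr (_ ++ _).
have -> : rdag (take n w) ++ [:: dagger b] = rdag (b :: take n w) by rewrite /rdag /= rev_cons cats1.
rewrite -drop1 -(drop_wins n0) wins_self; last by rewrite size_drop size_rdag /= size_takel //; lia.
have -> : drop 1 (rdag (b :: take n w)) = suff n (rdag (b :: take n w)).
  by rewrite /suff size_rdag /= size_takel //; congr drop; lia.
rewrite suff_rdag; congr [:: rdag _].
by case: (n) n0 => // m _ /=; rewrite take_takel.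
Qed.

(** Allowing lengths below [n] makes truncation by [insub_bseq] total; [path_value] still admits
    only trails of genuine windows. *)
Definition V := n.-bseq A.
Definition vdag (v : V) : V := insub_bseq n (rdag v).
Lemma val_vdag (v : V) : vdag v = rdag v :> seq A.
Proof. by rewrite /vdag /insub_bseq insubdK // -topredE /= size_rdag size_bseq. Qed.
Lemma vdagK : involutive vdag.
Proof. by move=> v; apply: val_inj; rewrite /= !val_vdag rdagK. Qed.

Definition path_value (p : seq V) (s : S) :=
  exists w, [/\ n <= size w, map val p = wins n w & hprod w = Some s].

Lemma path_value_fun p s s' : path_value p s -> path_value p s' -> s = s'.
Proof.
move=> [w [sw wE Es]] [w' [sw' wE' Es']].
have E : w = w' by apply: (wins_inj n0 sw sw'); rewrite -wE.
by move: Es'; rewrite -E Es => -[].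
Qed.

Lemma path_value_perm r p p' s : last r p = last r p' ->
  perm_eq (adj (r :: p)) (adj (r :: p')) -> path_value (r :: p) s -> path_value (r :: p') s.
Proof.
move=> lE perm [w [sw wE Es]].
have [q tE] := take_wins sw.
have rE : val r = take n w by move: wE; rewrite tE => -[].
have permv : perm_eq (adj (wins n w)) (adj (map val (r :: p'))).
  by rewrite -wE !(adj_map val); apply: perm_map.
have [||w' sw' wE'] := @wins_rebuild A n n0 (val r) (map val p').
- by rewrite rE size_takel.
- by move=> e; rewrite -(perm_mem permv); apply: (adj_wins_overlap n0).
exists w'; split=> //; rewrite /hprod.
have [q' tE'] := take_wins sw'.
have lw : suff n w = suff n w'.
  by rewrite -(last_wins n0 [::] sw) -(last_wins n0 [::] sw') -wE wE' /= !last_map lE.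
rewrite -Es /hprod; apply/esym/winv; rewrite ?size_map // -?map_take ?suff_map ?lw //.
  by congr map; rewrite -rE; move: wE'; rewrite tE' => -[].
rewrite !wins_map !(adj_map (map _)); apply: perm_map.
by rewrite wE'.
Qed.

Lemma hprod_Some w : 0 < size w -> exists s, hprod w = Some s.
Proof. by move=> w0; exists (h (Word w0)); apply: hprod_word. Qed.

(** Up to length [n.*2] the two ends cover the word, so [rdag c = c]. Beyond it, [c] is a prefix
    [u], a middle part, and [rdag u], and the hermitian identity reverses the middle part. *)
Lemma hprod_sandwich c : n <= size c -> take n (rdag c) = take n c ->
  suff n (rdag c) = suff n c -> hprod (rdag c) = hprod c.
Proof.
move=> sc tE sE; case: (leqP (size c) n.*2) => lc.
  by congr hprod; apply: (take_suff_inj n0 _ _ tE sE); rewrite size_rdag.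
have su : size (take n c) = n by rewrite size_takel.
have cE : c = take n c ++ take (size c - n.*2) (drop n c) ++ rdag (take n c).
  rewrite -suff_rdag sE -{1}(cat_take_drop n c); congr cat.
  rewrite -{1}(cat_take_drop (size c - n.*2) (drop n c)); congr cat.
  by rewrite drop_drop /suff; congr drop; lia.
have sm : 0 < size (take (size c - n.*2) (drop n c)).
  by rewrite size_takel ?size_drop; lia.
have su0 : 0 < size (take n c) by rewrite su.
have [a Ea] := hprod_Some su0; have [b Eb] := hprod_Some sm.
move: (take n c) (take (size c - _) _) su Ea Eb cE => u m su Ea Eb ->.
have -> : rdag (u ++ m ++ rdag u) = u ++ rdag m ++ rdag u.
  by rewrite {1}/rdag !map_cat !rev_cat -!/(rdag _) rdagK catA.
rewrite !hprod_cat Ea Eb (hprod_rdag Ea) (hprod_rdag Eb) /= !mulgA; congr Some.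
have su' : size (map (fun a => h (letter a)) u) = n by rewrite size_map.
by rewrite (herm b su' Ea).
Qed.

Lemma path_value_rev c0 r p c1 s : last r p = vdag r ->
  path_value (c0 ++ (r :: p) ++ c1) s -> path_value (c0 ++ drev vdag (r :: p) ++ c1) s.
Proof.
move=> lE [w [sw wE Es]].
pose P := map val (r :: p); pose w1 := drop (size c0) w; pose x := take (size c0) w.
have w1E : wins n w1 = P ++ map val c1.
  by rewrite (drop_wins n0) -wE map_cat drop_size_cat ?size_map // map_cat.
have szE : size p + size c1 + n = size w1.
  have := congr1 size w1E; rewrite size_wins size_cat /P !size_map /=.
  by move: (size p) (size c1) (size w1) => i j m; lia.
(* The word spelled by the subtrail [r :: p]. Replacing it by [rdag c] keeps its first and last
   windows, hence every window outside it. *)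
pose c := take (size p + n) w1; pose y := drop (size p + n) w1.
have w1cat : w1 = c ++ y by rewrite cat_take_drop.
have sc : size c = size p + n by rewrite size_takel //; lia.
have lc : n <= size c by rewrite sc; lia.
have sx : size x = size c0.
  rewrite size_takel //; have := congr1 size wE; rewrite size_wins size_map size_cat.
  by move: (size (_ ++ _)) (size c0) (size w) => i j m; lia.
have cE : wins n c = P.
  have szc : size (wins n c) = size P by rewrite size_wins sc /P size_map /=; move: (size p) => i; lia.
  by have := w1E; rewrite w1cat (wins_catl n0) // => /(cat_inj szc)[].
have yE : behead (wins n (suff n c ++ y)) = map val c1.
  by have := w1E; rewrite w1cat (wins_catl n0) // cE => /(cat_inj erefl)[].
have tc : take n c = val r.
  by have [q E] := take_wins lc; move: E; rewrite cE => -[].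
have sfc : suff n c = rdag (val r).
  by rewrite -(last_wins n0 [::] lc) cE /= last_map lE val_vdag.
have tE : take n (rdag c) = take n c by rewrite take_rdag sfc rdagK tc.
have sE : suff n (rdag c) = suff n c by rewrite suff_rdag sfc tc.
have lc' : n <= size (rdag c) by rewrite size_rdag.
have xE : take (size x) (wins n (x ++ take n (c ++ y))) = map val c0.
  have := wE; rewrite -{1}(cat_take_drop (size c0) w) -/x -/w1 (wins_catr n0); last by lia.
  rewrite map_cat w1cat => /cat_inj[|-> //].
  have scy : n <= size (c ++ y) by rewrite size_cat; lia.
  by rewrite size_map size_takel ?sx // size_wins size_cat sx size_takel //; lia.
exists (x ++ rdag c ++ y); split.
- by rewrite !size_cat size_rdag; lia.
- rewrite (wins_catr n0); last by rewrite size_cat size_rdag; lia.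
  have -> : take n (rdag c ++ y) = take n (c ++ y) by rewrite !takel_cat.
  rewrite xE (wins_catl n0) // sE yE wins_rdag // cE !map_cat; congr (_ ++ _ ++ _).
  rewrite /drev /P map_rev -!map_comp; congr rev; apply: eq_map => v /=.
  by rewrite val_vdag.
rewrite !hprod_cat hprod_sandwich // -!hprod_cat -w1cat cat_take_drop; exact: Es.
Qed.

Lemma wins_block (u : seq A) l q c : n <= size c -> wins n c = (u :: l) ++ u :: q ->
  exists g c2, [/\ c = g ++ c2, wins n c2 = u :: q, n <= size c2 & wins n (g ++ u) = rcons (u :: l) u].
Proof.
move=> sc cE; exists (take (size l).+1 c), (drop (size l).+1 c).
have szE : size l + size q + n.+1 = size c.
  by have := congr1 size cE; rewrite size_wins size_cat /=; lia.
have s2 : n <= size (drop (size l).+1 c) by rewrite size_drop; lia.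
have c2E : wins n (drop (size l).+1 c) = u :: q by rewrite (drop_wins n0) cE drop_size_cat.
have uE : take n (drop (size l).+1 c) = u.
  by have [q' E] := take_wins s2; move: E; rewrite c2E => -[].
split=> //; first by rewrite cat_take_drop.
have := cE; rewrite -{1}(cat_take_drop (size l).+1 c) (wins_catr n0) // uE c2E.
have su : size u = n by rewrite -uE size_takel.
have tl : size (take (size l).+1 c) = (size l).+1 by rewrite size_takel //; lia.
case/cat_inj => [|E _].
  by rewrite tl size_takel // size_wins size_cat tl su; lia.
have un : take n u = u by rewrite -su take_size.
by rewrite (wins_catr n0) ?su // un (wins_self su) E cats1.
Qed.

(** Every turn reads a word whose extension by [u] has the same list of windows, so all turns read
    the same [g] and the word starts with a power of [g]. *)
Lemma wins_blocks (u : seq A) l g : wins n (g ++ u) = rcons (u :: l) u -> size u = n ->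
  forall N q c, n <= size c -> wins n c = flatten (nseq N (u :: l)) ++ u :: q ->
  exists2 c2, c = flatten (nseq N g) ++ c2 & n <= size c2 /\ wins n c2 = u :: q.
Proof.
move=> gE su; elim=> [|N IH] q c sc cE; first by exists c.
have [q' E'] : exists q', flatten (nseq N (u :: l)) ++ u :: q = u :: q'.
  by case: (N) => [|N'] /=; eexists.
have := cE; rewrite flatten_nseqS -catA E'.
case/(wins_block sc) => g' [c2 [-> c2E s2 g'E]].
have Eg : g' ++ u = g ++ u.
  by apply: (wins_inj n0); rewrite ?size_cat ?su ?leq_addl // g'E.
have sg : size g' = size g by have := congr1 size Eg; rewrite !size_cat; lia.
have [-> _] := cat_inj sg Eg.
have [c3 -> h3] := IH q c2 s2 (etrans c2E (esym E')).
by exists c3 => //=; rewrite catA.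
Qed.

Lemma path_value_pump c0 u l c1 s :
  path_value (c0 ++ flatten (nseq k.+1 (u :: l)) ++ u :: c1) s ->
  path_value (c0 ++ flatten (nseq k.+2 (u :: l)) ++ u :: c1) s.
Proof.
move=> [w [sw wE Es]]; pose x := take (size c0) w; pose c := drop (size c0) w.
pose U := val u; pose L := map val l.
have fE N : map val (flatten (nseq N (u :: l))) = flatten (nseq N (U :: L)).
  by elim: N => // N IH; rewrite !flatten_nseqS map_cat IH.
have cE : wins n c = flatten (nseq k.+1 (U :: L)) ++ U :: map val c1.
  by rewrite (drop_wins n0) -wE map_cat drop_size_cat ?size_map // map_cat fE.
have sc : n <= size c.
  by have := congr1 size cE; rewrite size_wins size_cat /=; lia.
have [q' E'] : exists q', flatten (nseq k (U :: L)) ++ U :: map val c1 = U :: q'.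
  by case: (k) => [|k'] /=; eexists.
have := cE; rewrite flatten_nseqS -catA E'.
case/(wins_block sc) => g [c2 [cg c2E s2 gE]].
have t2 : take n c2 = U by have [q E] := take_wins s2; move: E; rewrite c2E => -[].
have tc : take n c = U by have [q E] := take_wins sc; move: E; rewrite cE => -[].
have sU : size U = n by rewrite -tc size_takel.
have sg : size g = (size L).+1.
  by have := congr1 size gE; rewrite size_wins size_cat sU size_rcons /=; lia.
have [c3 c3E [s3 _]] := wins_blocks gE sU sc cE.
have sx : size x = size c0.
  rewrite size_takel //; have := congr1 size wE; rewrite size_wins size_map size_cat.
  by move: (size (_ ++ _)) (size c0) (size w) => i j m; lia.
have xE : take (size x) (wins n (x ++ take n c)) = map val c0.
  have := wE; rewrite -{1}(cat_take_drop (size c0) w) -/x -/c (wins_catr n0) //.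
  rewrite map_cat => /cat_inj[|-> //].
  by rewrite size_map size_takel ?sx // size_wins size_cat sx size_takel //; lia.
have gcE : wins n (g ++ c) = (U :: L) ++ wins n c.
  rewrite (wins_catr n0) // tc gE -cats1; congr cat.
  by rewrite sg take_size_cat.
have tgc : take n (g ++ c) = U.
  have sgc : n <= size (g ++ c) by rewrite size_cat; lia.
  by have [q E] := take_wins sgc; move: E; rewrite gcE => -[].
exists (x ++ g ++ c); split.
- by rewrite !size_cat; lia.
- rewrite (wins_catr n0); last by rewrite size_cat; lia.
  have -> : take n (g ++ c) = take n c by rewrite tgc tc.
  by rewrite xE gcE cE 2!map_cat fE (flatten_nseqS k.+1) -catA.
have [a Ea] : exists a, hprod g = Some a by apply: hprod_Some; rewrite sg.
have fg N : hprod (flatten (nseq N.+1 g)) = Some (spow a N).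
  by elim: N => [|N IH]; [rewrite /= cats0 | rewrite flatten_nseqS hprod_cat IH Ea].
have -> : g ++ c = flatten (nseq k.+2 g) ++ c3 by rewrite c3E catA.
(* Here [k.+2] turns multiply to [spow a k.+1], which aperiodicity identifies with the value
   [spow a k] of [k.+1] turns. *)
rewrite 2!hprod_cat fg ap -fg -!hprod_cat -c3E cat_take_drop; exact: Es.
Qed.

Definition vwins (w : seq A) : seq V := map (@insub_bseq n A) (wins n w).

Lemma val_insub_bseq (x : seq A) : size x <= n -> insub_bseq n x = x :> seq A.
Proof. by move=> le; rewrite /insub_bseq insubdK. Qed.

Lemma val_vwins w : map val (vwins w) = wins n w.
Proof.
rewrite -map_comp; apply: map_id_in => x /mapP[i _ ->] /=.
by rewrite val_insub_bseq // size_take_min geq_minl.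
Qed.

Definition vedge (x : seq A) : V * V := (insub_bseq n (take n x), insub_bseq n (drop 1 x)).

Lemma vedge_inj x y : size x = n.+1 -> size y = n.+1 -> vedge x = vedge y -> x = y.
Proof.
move=> sx sy [/(congr1 val) /= E1 /(congr1 val) /= E2].
move: E1 E2; rewrite !val_insub_bseq ?size_drop ?size_takel ?sx ?sy ?subn1 // => E1 E2.
rewrite -(cat_take_drop 1 x) -(cat_take_drop 1 y) E2; congr cat.
by rewrite -[take 1 x](take_takel _ n0) -[take 1 y](take_takel _ n0) E1.
Qed.

Lemma opp_vedge x : size x = n.+1 -> opp_edge vdag (vedge x) = vedge (rdag x).
Proof.
move=> sx.
have d1 y : size y = n.+1 -> drop 1 y = suff n y by move=> sy; rewrite /suff sy subSnn.
congr pair; apply: val_inj; rewrite /= val_vdag !val_insub_bseq ?size_drop ?size_takel ?size_rdag ?sx ?subn1 //.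
  by rewrite take_rdag d1.
by rewrite [RHS]d1 ?size_rdag // suff_rdag.
Qed.

Lemma adj_vwins w : n <= size w -> adj (vwins w) =
  [seq vedge (take n.+1 (drop i w)) | i <- iota 0 (size w - n)].
Proof.
move=> sw; rewrite /vwins (adj_map (@insub_bseq n A)) adj_wins // -map_comp.
apply: eq_map => i /=; rewrite /vedge take_takel //; congr (_, insub_bseq _ _).
by rewrite -[i.+1]add1n -drop_drop take_drop addn1.
Qed.

(** Edge counts become factor counts here. Of the positions listed in [occE], the last [n + 1] leave
    too few letters for a factor of length [n + 1]. *)
Lemma cnt_vwins (w x : word A) : size x = n.+1 -> n <= size w ->
  cnt vdag (vwins w) (vedge x) = occ w x.
Proof.
move=> sx sw; rewrite /cnt adj_vwins // count_map occE.
have -> : (size w).+1 = (size w - n) + n.+1 by lia.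
rewrite iotaD count_cat [X in _ + X](_ : _ = 0) ?addn0.
  apply: eq_in_count => i; rewrite mem_iota => /andP[_ lt]; rewrite /= /same_edge opp_vedge // sx.
  have sz : size (take n.+1 (drop i w)) = n.+1 by rewrite size_takel // size_drop; lia.
  by congr orb; apply/eqP/eqP => [/vedge_inj -> //|->//]; rewrite size_rdag.
apply/eqP; rewrite -leqn0 leqNgt -has_count; apply/hasPn => i.
rewrite mem_iota => /andP[ge _]; rewrite sx.
have ne (y : seq A) : size y = n.+1 -> (take n.+1 (drop i w) == y) = false.
  move=> sy; apply/eqP => /(congr1 size); rewrite sy size_take_min size_drop.
  by move: ge; move: (size w) => m; lia.
by rewrite !ne // size_rdag.
Qed.

Lemma cnt_opp p e : cnt vdag p (opp_edge vdag e) = cnt vdag p e.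
Proof.
rewrite /cnt; apply: eq_count => f.
by rewrite (same_edge_sym vdagK) (same_edge_opp vdagK) (same_edge_sym vdagK).
Qed.

Lemma cnt_vedge w e : n <= size w -> 0 < cnt vdag (vwins w) e ->
  exists2 x, size x = n.+1 & forall p, cnt vdag p e = cnt vdag p (vedge x).
Proof.
move=> sw; rewrite -has_count adj_vwins // => /hasP[f /mapP[i]].
rewrite mem_iota => /andP[_ lt] -> se; exists (take n.+1 (drop i w)).
  by rewrite size_takel // size_drop; lia.
by move=> p; case/orP: se => /eqP ->; rewrite ?cnt_opp.
Qed.

(** At level [n.+1] the common prefix and suffix of length [n] are the end vertices of the trails,
    and the factors of length [n.+1] are their edges. *)
Lemma approx_value : exists t, forall w w' : word A, approx t n.+1 w w' -> h w = h w'.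
Proof.
have [t ht] := val_threshold vdagK path_value_perm path_value_rev path_value_pump path_value_fun.
exists t => w w' [[_ -> //]|[sw sw' tE sE cE]].
have val_w (u : word A) : path_value (vwins u) (h u) \/ size u < n.
  case: (leqP n (size u)) => su; [left | by right].
  exists u; split=> //; first exact: val_vwins.
  by rewrite (hprod_word (wordP u)); congr (Some (h _)); apply: val_inj.
have lw : n <= size w by lia.
have lw' : n <= size w' by lia.
case: (val_w w) => [vw|]; last by lia.
case: (val_w w') => [vw'|]; last by lia.
have counts e : eq_threshold t (cnt vdag (vwins w) e) (cnt vdag (vwins w') e).
  have via x : size x = n.+1 -> eq_threshold t (cnt vdag (vwins w) (vedge x)) (cnt vdag (vwins w') (vedge x)).
    move=> sx; have x0 : 0 < size x by rewrite sx.
    by rewrite !(@cnt_vwins _ (Word x0)) //; apply: cE; rewrite /= sx.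
  case: (posnP (cnt vdag (vwins w) e)) => [z1|/(cnt_vedge lw)[x sx E]]; last by rewrite !E; apply: via.
  case: (posnP (cnt vdag (vwins w') e)) => [z2|/(cnt_vedge lw')[x sx E]]; last by rewrite !E; apply: via.
  by rewrite z1 z2 /eq_threshold; lia.
have [q E] := take_wins lw; have [q' E'] := take_wins lw'.
have last_eq : last [::] (wins n w) = last [::] (wins n w') by rewrite !(last_wins n0).
move: vw vw' counts last_eq; rewrite /vwins E E' /= tE => vw vw' counts last_eq.
apply: (ht _ _ _ _ _ _ counts vw vw').
by rewrite !last_map last_eq.
Qed.
End Recognition.

Lemma approx_refl (A : invAlphabetType) t k (w : word A) : approx t k w w.
Proof.
case: (ltnP (size w) k) => le; [by left | right; split=> // v _].
by rewrite /eq_threshold; case: (ltnP (occ w v) t); [left | right].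
Qed.

Lemma approx_leq (A : invAlphabetType) t t' k (w w' : word A) :
  t <= t' -> approx t' k w w' -> approx t k w w'.
Proof.
move=> le [[]|[? ? ? ? h]]; [by left | right; split=> // v /h].
exact: eq_threshold_leq.
Qed.

Theorem reversible_lt_LRTT (S : finStarSemigroupType) (A : invAlphabetType) (L : set (word A)) :
  reversible_lt S -> recognised_by S L -> LRTT L.
Proof.
move=> [[k ap] [n1 winv] [n2 herm]] [h hmor [P ->]].
pose n := (n1 + n2).+1.
have [t ht] := @approx_value A S h hmor n k isT (winv n (leqW (leq_addr _ _)))
  (herm n (leqW (leq_addl _ _))) ap.
exists t.+1, n.+1; split=> //; exists (h @^-1` P)%classic.
apply/seteqP; split=> [w Pw|w [u Pu uw]]; first by exists w => //; apply: approx_refl.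
by rewrite /preimage /= -(ht u w) //; apply: approx_leq uw.
Qed.

Local Open Scope classical_set_scope.
Local Open Scope group_scope.

(** * Pseudovarieties and the Eilenberg correspondence *)

Lemma pv_generated_pseudovariety G : pseudovariety (pv_generated G).
Proof.
split.
- by move=> V [].
- move=> S T vS vT V pV GV; have [_ prodV _ _] := pV.
  by apply: prodV; [apply: vS | apply: vT].
- move=> S T f fm fi vT V pV GV; have [_ _ subV _] := pV.
  by apply: subV fm fi _; apply: vT.
- move=> S T f fm fs vS V pV GV; have [_ _ _ quoV] := pV.
  by apply: quoV fm fs _; apply: vS.
Qed.

Section SubSemigroup.
Variables (S : finStarSemigroupType) (P : pred S).
Hypotheses (PM : forall x y, P x -> P y -> P (x * y)) (Pd : forall x, P x -> P (dagger x)).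

(** The closure proofs are arguments of the type, so that the instances declared on it can recover
    them. *)
Definition substar (_ : forall x y, P x -> P y -> P (x * y))
  (_ : forall x, P x -> P (dagger x)) : Type := {x | P x}.
Local Notation U := (substar PM Pd).

HB.instance Definition _ := Finite.on U.

Definition substar_mul (x y : U) : U := exist _ (sval x * sval y) (PM (svalP x) (svalP y)).
Fact substar_mulA : associative substar_mul.
Proof. by move=> x y z; apply: val_inj; rewrite /= mulgA. Qed.
HB.instance Definition _ := isSemigroup.Build U substar_mulA.

Definition substar_dagger (x : U) : U := exist _ (dagger (sval x)) (Pd (svalP x)).
Fact substar_daggerK : involutive substar_dagger.
Proof. by move=> x; apply: val_inj; rewrite /= daggerK. Qed.
HB.instance Definition _ := hasInvolution.Build U substar_daggerK.
Fact substar_daggerM : {morph (@dagger U) : x y / x * y >-> y * x}.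
Proof. by move=> x y; apply: val_inj; rewrite /= daggerM. Qed.
HB.instance Definition _ := Semigroup_isStar.Build U substar_daggerM.
End SubSemigroup.

Lemma pseudovariety_division (V : pv_class) (S T : finStarSemigroupType) (P : pred S)
    (g : S -> T) : pseudovariety V -> V S ->
  (forall x y, P x -> P y -> P (x * y)) -> (forall x, P x -> P (dagger x)) ->
  {in P &, {morph g : x y / x * y}} -> {in P, {morph g : x / dagger x}} ->
  (forall t, exists2 s, P s & g s = t) -> V T.
Proof.
move=> [_ _ subV quoV] VS PM Pd gM gd gs.
pose U : finStarSemigroupType := substar PM Pd.
have VU : V U by apply: (subV U S sval) => //; exact: val_inj.
apply: (quoV U T (fun x => g (sval x))) => //.
  by split=> [[x px] [y py]|[x px]]; [apply: gM | apply: gd].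
by move=> t; have [s Ps <-] := gs t; exists (exist _ s Ps).
Qed.

Section QuotientSemigroup.
Variables (S : finStarSemigroupType) (R : S -> S -> Prop).
Hypotheses (Rr : forall x, R x x) (Rs : forall x y, R x y -> R y x)
  (Rt : forall x y z, R x y -> R y z -> R x z)
  (RM : forall x x' y y', R x x' -> R y y' -> R (x * y) (x' * y'))
  (Rd : forall x x', R x x' -> R (dagger x) (dagger x')).

(** Choosing one element per class makes the quotient a subtype of [S], which inherits
    finiteness. *)
Definition class_rep (x : S) : S := choose (fun y => `[< R x y >]) x.

Lemma class_repP x : R x (class_rep x).
Proof. by apply/asboolP; apply: (chooseP (P := fun y => `[< R x y >])); apply/asboolP. Qed.

Lemma class_rep_eq x y : R x y <-> class_rep x = class_rep y.
Proof.
split=> [xy|E]; last by apply: Rt (class_repP x) _; rewrite E; apply/Rs/class_repP.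
rewrite /class_rep (eq_choose (Q := fun z => `[< R y z >])).
  by apply: choose_id; apply/asboolP; [apply: Rs | ].
by move=> z; apply: asbool_equiv_eq; split; apply: Rt => //; apply: Rs.
Qed.

Definition quostar (_ : forall x, R x x) (_ : forall x y, R x y -> R y x)
  (_ : forall x y z, R x y -> R y z -> R x z)
  (_ : forall x x' y y', R x x' -> R y y' -> R (x * y) (x' * y'))
  (_ : forall x x', R x x' -> R (dagger x) (dagger x')) : Type :=
  {x : S | class_rep x == x}.
Local Notation Q := (quostar Rr Rs Rt RM Rd).

HB.instance Definition _ := Finite.on Q.

Fact quo_subproof x : class_rep (class_rep x) == class_rep x.
Proof. by apply/eqP/class_rep_eq/Rs/class_repP. Qed.
Definition quo_pi (x : S) : Q := exist _ (class_rep x) (quo_subproof x).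

Lemma quo_pi_eq x y : quo_pi x = quo_pi y <-> R x y.
Proof.
rewrite class_rep_eq; split=> [/(congr1 sval) //|E].
by apply: val_inj.
Qed.

Lemma quo_piK (q : Q) : quo_pi (sval q) = q.
Proof. by apply: val_inj; rewrite /=; apply/eqP; exact: svalP q. Qed.

Definition quo_mul (x y : Q) : Q := quo_pi (sval x * sval y).
Lemma quo_mul_pi x y : quo_mul (quo_pi x) (quo_pi y) = quo_pi (x * y).
Proof. by apply/quo_pi_eq; apply: RM; apply/Rs/class_repP. Qed.
Fact quo_mulA : associative quo_mul.
Proof.
move=> x y z; rewrite -(quo_piK x) -(quo_piK y) -(quo_piK z) !quo_mul_pi.
by rewrite mulgA.
Qed.
HB.instance Definition _ := isSemigroup.Build Q quo_mulA.

Definition quo_dagger (x : Q) : Q := quo_pi (dagger (sval x)).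
Lemma quo_dagger_pi x : quo_dagger (quo_pi x) = quo_pi (dagger x).
Proof. by apply/quo_pi_eq; apply: Rd; apply/Rs/class_repP. Qed.
Fact quo_daggerK : involutive quo_dagger.
Proof. by move=> x; rewrite -(quo_piK x) !quo_dagger_pi daggerK. Qed.
HB.instance Definition _ := hasInvolution.Build Q quo_daggerK.
Fact quo_daggerM : {morph (@dagger Q) : x y / x * y >-> y * x}.
Proof.
move=> x y; rewrite -(quo_piK x) -(quo_piK y).
rewrite [_ * _]quo_mul_pi [LHS]quo_dagger_pi daggerM.
by rewrite -quo_mul_pi -!quo_dagger_pi.
Qed.
HB.instance Definition _ := Semigroup_isStar.Build Q quo_daggerM.

Lemma quo_pi_morphism : star_morphism (quo_pi : S -> Q).
Proof. by split=> [x y|x]; rewrite -?quo_mul_pi -?quo_dagger_pi. Qed.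
End QuotientSemigroup.

Section LanguagesOf.
Variables (V : pv_class).
Hypothesis pV : pseudovariety V.

Lemma recognised_regular (A : invAlphabetType) (S : finStarSemigroupType) (L : set (word A)) :
  recognised_by S L -> regular L.
Proof.
case=> h [hM hd] [P ->].
(* [None] is the initial state: the empty word has no image in a semigroup. *)
pose f q a := if q is Some s then Some (s * h (letter a)) else Some (h (letter a)).
exists (option S), None, f, (fun q : option S => `[< if q is Some s then P s else False >]).
have runE (s : S) (w : word A) : foldl f (Some s) w = Some (s * h w).
  case: w => w w0 /=; elim: w w0 s => // a [|b w] IH w0 s.
    by congr (Some (_ * h _)); apply: val_inj.
  apply: etrans (IH isT (s * h (letter a))) _.
  rewrite -mulgA -hM; congr (Some (_ * h _)); exact: val_inj.
have run0 (w : word A) : foldl f None w = Some (h w).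
  case: w => -[|a [|b w]] w0 //; first by congr (Some (h _)); apply: val_inj.
  apply: etrans (runE (h (letter a)) (Word (isT : 0 < size (b :: w)))) _.
  by rewrite -hM; congr (Some (h _)); apply: val_inj.
by apply/seteqP; split=> w; rewrite /= unfold_in run0 => /asboolP.
Qed.

Lemma languages_of_combine (A : invAlphabetType) (L K : set (word A)) (op : Prop -> Prop -> Prop) :
  languages_of V L -> languages_of V K -> languages_of V [set w | op (L w) (K w)].
Proof.
move=> [S VS [h [hM hd] [P ->]]] [T VT [g [gM gd] [Q ->]]].
have [_ prodV _ _] := pV.
exists (S * T)%type; first exact: prodV.
exists (fun w => (h w, g w)); first by split=> [u v|u]; rewrite ?hM ?gM ?hd ?gd.
by exists [set p | op (P p.1) (Q p.2)].
Qed.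

Theorem languages_of_variety : involution_variety (languages_of V).
Proof.
have [unitV _ _ _] := pV.
have trivial_lang (A : invAlphabetType) (p : Prop) : languages_of V [set w : word A | p].
  by exists unit => //; exists (fun=> tt) => //; exists [set _ | p].
split.
- by move=> A L [S _ /recognised_regular].
- by move=> A; apply: (trivial_lang A False).
- by move=> A; apply: (trivial_lang A True).
- by move=> A L K; apply: languages_of_combine or.
- by move=> A L K; apply: languages_of_combine and.
- by move=> A L [S VS [h hm [P ->]]]; exists S => //; exists h => //; exists (~` P).
- move=> A a L [S VS [h hm [P ->]]]; exists S => //; exists h => //.
  have [hM _] := hm; exists [set s | P (h (letter a) * s)].
  by apply/seteqP; split=> w; rewrite /preimage /= hM.
- move=> A a L [S VS [h hm [P ->]]]; exists S => //; exists h => //.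
  have [hM _] := hm; exists [set s | P (s * h (letter a))].
  by apply/seteqP; split=> w; rewrite /preimage /= hM.
- move=> A L [S VS [h hm [P ->]]]; exists S => //; exists h => //.
  have [_ hd] := hm; exists [set s | P (dagger s)].
  apply/seteqP; split=> [_ [w Pw <-]|w]; first by rewrite /preimage /= -hd daggerK.
  by rewrite /preimage /= -hd => Pw; exists (dagger w); rewrite ?daggerK.
- move=> A B g L [gM gd] [S VS [h [hM hd] [P ->]]]; exists S => //; exists (h \o g); last by exists P.
  by split=> [u v|u]; rewrite /= ?gM ?gd ?hM ?hd.
Qed.

Lemma morphism_in_context (A : invAlphabetType) (S : semigroupType) (h : word A -> S)
    (hM : {morph h : x y / x * y}) (x y : seq A) (u v : word A) :
  h u = h v -> h (in_context x u y) = h (in_context x v y).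
Proof.
move=> E.
have pre (x' : seq A) (u1 v1 : word A) : h u1 = h v1 ->
    forall (p : 0 < size (x' ++ u1)) (q : 0 < size (x' ++ v1)), h (Word p) = h (Word q).
  move=> E1; elim: x' => [|a x' IH] p q.
    have -> : Word p = u1 by apply: val_inj.
    by have -> : Word q = v1 by apply: val_inj.
  have p' : 0 < size (x' ++ u1) by rewrite size_cat ltn_addl // wordP.
  have q' : 0 < size (x' ++ v1) by rewrite size_cat ltn_addl // wordP.
  have -> : Word p = letter a * Word p' by apply: val_inj.
  have -> : Word q = letter a * Word q' by apply: val_inj.
  by rewrite !hM (IH p' q').
have p1 (w : word A) : 0 < size (w ++ y) by rewrite size_cat ltn_addr // wordP.
have Ey : h (Word (p1 u)) = h (Word (p1 v)).
  case: (posnP (size y)) => [/size0nil y0|y0].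
    have E1 w : Word (p1 w) = w by apply: val_inj; rewrite /= y0 cats0.
    by rewrite !E1.
  have EW w : Word (p1 w) = w * Word y0 by apply: val_inj.
  by rewrite !EW !hM E.
exact: (pre x (Word (p1 u)) (Word (p1 v)) Ey).
Qed.

(** Words with the same image under [h] are syntactically equivalent, so [X] is a quotient of the
    image of [h], which is a subsemigroup of [S]. *)
Lemma syntactic_in_pseudovariety (A : invAlphabetType) (L : set (word A)) (X : finStarSemigroupType) :
  languages_of V L -> syntactic_star_semigroup L X -> V X.
Proof.
move=> [S VS [h [hM hd] [P LE]]] [eta [[eM ed] eS eE]].
have cong u v : h u = h v -> eta u = eta v.
  move=> huv; apply/eE => x y; rewrite LE /preimage /=.
  have ctx (u' v' : word A) (E : h u' = h v') := morphism_in_context hM x y E.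
  by rewrite (ctx u v) // (ctx (dagger u) (dagger v)) // !hd huv.
have /choice[pre preE] : forall s : S, exists w : option (word A), (exists u, h u = s) -> exists2 u, w = Some u & h u = s.
  move=> s; case: (EM (exists u, h u = s)) => [[u E]|n]; first by exists (Some u) => _; exists u.
  by exists None => /n.
pose Im : pred S := fun s => `[< exists u, h u = s >].
(* Over the empty alphabet no word can serve as default value for [g]; then [X] is empty and embeds
   in [unit]. *)
case: (EM (exists u0 : word A, True)) => [[u0 _]|nw]; last first.
  have nX (x : X) : False by have [u _] := eS x; apply: nw; exists u.
  have [unitV _ subV _] := pV.
  by apply: (subV X unit (fun=> tt)) => // x; case: (nX x).
pose g s := if pre s is Some u then eta u else eta u0.
have gE u : g (h u) = eta u.
  by rewrite /g; have [v -> /cong] := preE (h u) (ex_intro _ u erefl).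
apply: (pseudovariety_division (P := Im) (g := g) pV VS).
- by move=> x y /asboolP[u <-] /asboolP[v <-]; apply/asboolP; exists (u * v).
- by move=> x /asboolP[u <-]; apply/asboolP; exists (dagger u).
- by move=> x y /asboolP[u <-] /asboolP[v <-]; rewrite -hM !gE eM.
- by move=> x /asboolP[u <-]; rewrite -hd !gE ed.
by move=> x; have [u <-] := eS x; exists (h u) => //; apply/asboolP; exists u.
Qed.

Lemma syntactic_eq_mul (A : invAlphabetType) (L : set (word A)) (u u' v v' : word A) :
  syntactic_eq L u u' -> syntactic_eq L v v' -> syntactic_eq L (u * v) (u' * v').
Proof.
move=> uu vv x y; have E1 (a b : word A) : in_context x (a * b) y = in_context x a (b ++ y).
  by apply: val_inj; rewrite /= -catA.
have E2 (a b : word A) : in_context x (a * b) y = in_context (x ++ a) b y.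
  by apply: val_inj; rewrite /= -!catA.
rewrite !daggerM E1 (E1 (dagger v)); split.
  by rewrite (uu x (v ++ y)).1 -E1 E2 (vv (x ++ u') y).1 -E2.
by rewrite (vv x (dagger u ++ y)).2 -E1 E2 (uu (x ++ dagger v') y).2 -E2.
Qed.

Lemma syntactic_eq_dagger (A : invAlphabetType) (L : set (word A)) (u v : word A) :
  syntactic_eq L u v -> syntactic_eq L (dagger u) (dagger v).
Proof. by move=> uv x y; rewrite !daggerK; have [] := uv x y. Qed.

Lemma evaluation (S : finStarSemigroupType) :
  exists2 ev : word S -> S, star_morphism ev & forall a, ev (letter a) = a.
Proof.
have /choice[ev evE] : forall w : word S, exists s : S, if wseq w is a :: w' then s = foldl mul a w' else True.
  by case=> -[|a w] w0 //; exists (foldl mul a w).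
have ev1 a : ev (letter a) = a by exact: evE (letter a).
have foldlM (a b : S) w : foldl mul (a * b) w = a * foldl mul b w.
  by elim: w b => //= c w IH b; rewrite -mulgA IH.
have evM : {morph ev : u v / u * v}.
  move=> u v; move: (evE u) (evE v) (evE (u * v)).
  case: u v => -[|a u] // ? [[|b v] // ?] /= -> -> ->.
  by rewrite foldl_cat /= foldlM.
exists ev => //; split=> // -[w w0]; elim: w w0 => // a [|b w] IH w0.
  have -> : Word w0 = letter a by apply: val_inj.
  have -> : dagger (letter a) = letter (dagger a) by apply: val_inj.
  by rewrite !ev1.
have -> : Word w0 = letter a * Word (isT : 0 < size (b :: w)) by apply: val_inj.
rewrite daggerM !evM IH daggerM; congr (_ * _).
have -> : dagger (letter a) = letter (dagger a) by apply: val_inj.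
by rewrite !ev1.
Qed.

(** [S] serves as its own alphabet. The syntactic quotients of the languages [L s] jointly separate
    its elements: if [a] and [b] are identified for [L a], the empty context gives [b = a]. So [S]
    embeds in their product. *)
Lemma pv_of_languages (S : finStarSemigroupType) : V S -> pv_of (languages_of V) S.
Proof.
move=> VS W pW GW; have [unitW prodW subW _] := pW.
have [ev evm ev1] := evaluation S; have [evM evd] := evm.
pose L (s : S) : set (word S) := ev @^-1` [set s].
pose R s a b := syntactic_eq (L s) (letter a) (letter b).
have RE s u v : R s (ev u) (ev v) <-> syntactic_eq (L s) u v.
  have ctx x y (w : word S) : L s (in_context x (letter (ev w)) y) = L s (in_context x w y).
    by rewrite /L /preimage /= (morphism_in_context evM x y (ev1 (ev w))).
  have dl a : dagger (letter a) = letter (dagger a) :> word S by apply: val_inj.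
  by split=> h x y; have := h x y; rewrite !dl -!evd !ctx.
have lift (a : S) : exists u, ev u = a by exists (letter a).
have WR s : exists2 Q : finStarSemigroupType, W Q & exists2 f : S -> Q, star_morphism f &
    forall a b, f a = f b -> R s a b.
  have Rr x : R s x x by [].
  have Rs x y : R s x y -> R s y x.
    by move=> h p q; have [h1 h2] := h p q; split; apply: iff_sym.
  have Rt x y z : R s x y -> R s y z -> R s x z.
    by move=> h k p q; have [h1 h2] := h p q; have [k1 k2] := k p q; split; [apply: iff_trans h1 k1 | apply: iff_trans h2 k2].
  have RM x x' y y' : R s x x' -> R s y y' -> R s (x * y) (x' * y').
    rewrite -[x]ev1 -[x']ev1 -[y]ev1 -[y']ev1 -!evM => /RE h1 /RE h2.
    by apply/RE; apply: syntactic_eq_mul.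
  have Rd x x' : R s x x' -> R s (dagger x) (dagger x').
    rewrite -[x]ev1 -[x']ev1 -!evd => /RE h1.
    by apply/RE; apply: syntactic_eq_dagger.
  pose Q : finStarSemigroupType := quostar Rr Rs Rt RM Rd.
  have [piM pid] : star_morphism (quo_pi Rr Rs Rt RM Rd : S -> Q) := quo_pi_morphism Rr Rs Rt RM Rd.
  exists Q; last first.
    by exists (quo_pi Rr Rs Rt RM Rd : S -> Q) => // a b /quo_pi_eq.
  apply: GW; exists S, (L s); split.
    by exists S => //; exists ev => //; exists [set s].
  exists (fun u => quo_pi Rr Rs Rt RM Rd (ev u) : Q); split.
  - by split=> [u v|u]; rewrite ?evM ?evd ?piM ?pid.
  - by move=> q; have [u E] := lift (sval q); exists u; rewrite E; apply: quo_piK.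
  - by move=> u v; rewrite -RE; apply: quo_pi_eq.
have [Q WQ [f fm fR]] : exists2 Q : finStarSemigroupType, W Q & exists2 f : S -> Q, star_morphism f &
    forall a b, f a = f b -> forall s, s \in enum S -> R s a b.
  elim: (enum S) => [|s l [Q WQ [f [fM fd] fR]]].
    by exists unit => //; exists (fun=> tt).
  have [Q' WQ' [g [gM gd] gR]] := WR s.
  exists (Q * Q')%type; first exact: prodW.
  exists (fun a => (f a, g a)); first by split=> [a b|a]; rewrite ?fM ?gM ?fd ?gd.
  move=> a b [/fR h /gR k] s'; rewrite in_cons => /orP[/eqP -> //|]; exact: h.
apply: (subW S Q f) => // a b /fR /(_ a); rewrite mem_enum => /(_ isT) h.
have [[h1 _] _] := h [::] [::].
have E (c : S) : in_context [::] (letter c) [::] = letter c by apply: val_inj.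
by move: h1; rewrite !E /L /preimage /= !ev1 => /(_ erefl).
Qed.

End LanguagesOf.

(** * Recognition of threshold testable languages by a semidirect product *)

Section Marking.
Variable A : invAlphabetType.
Implicit Types z x y w : seq A.

Definition starts z s : bool := (take (size z) s == z) || (take (size z) s == rdag z).
Definition finishes z s : bool := (suff (size z) s == z) || (suff (size z) s == rdag z).

Lemma rdag_eq x y : (rdag x == y) = (x == rdag y).
Proof. by apply/eqP/eqP => [<-|->]; rewrite rdagK. Qed.

Lemma starts_rdag z s : starts z (rdag s) = finishes z s.
Proof. by rewrite /starts take_rdag !rdag_eq rdagK orbC. Qed.

Lemma finishes_rdag z s : finishes z (rdag s) = starts z s.
Proof. by rewrite -starts_rdag rdagK. Qed.

(* Each occurrence is marked at both of its ends: the involution exchanges the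
   first and the last letter of an occurrence. *)
Fixpoint marks z x w y : nat :=
  if w is a :: w' then
    (starts z (a :: w' ++ y) + finishes z (rcons x a) + marks z (rcons x a) w' y)%N
  else 0%N.

Lemma marks_cat z x w w' y :
  marks z x (w ++ w') y = (marks z x w (w' ++ y) + marks z (x ++ w) w' y)%N.
Proof.
elim: w x => [|a w IH] x /=; first by rewrite cats0.
by rewrite IH -catA cat_rcons addnA.
Qed.

(** Reversal exchanges [starts] and [finishes]; marking first letters alone would not be
    symmetric. *)
Lemma marks_rdag z x w y : marks z (rdag y) (rdag w) (rdag x) = marks z x w y.
Proof.
elim: w x => // a w IH x.
have rE s b : rdag (b :: s) = rdag s ++ [:: dagger b] by rewrite /rdag /= rev_cons cats1.
rewrite rE marks_cat /= addn0.
have -> : dagger a :: rdag x = rdag (rcons x a) by rewrite /rdag map_rcons rev_rcons.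
have -> : rcons (rdag y ++ rdag w) (dagger a) = rdag (a :: w ++ y).
  by rewrite rE -cats1 /rdag map_cat rev_cat.
by rewrite IH starts_rdag finishes_rdag addnC (addnC (finishes _ _ : nat)).
Qed.

Lemma marks_occ (w z : word A) : marks z [::] w [::] = (occ w z).*2.
Proof.
have E (x v : seq A) : marks z x v [::] = (count (fun i => starts z (drop i v)) (iota 0 (size v)) +
    count (fun i => finishes z (x ++ take i.+1 v)) (iota 0 (size v)))%N.
  elim: v x => // a v IH x; rewrite /= cats0 IH take0 cats1 (iotaDl 1 0) !count_map.
  rewrite (eq_count (a1 := preim _ (fun i => finishes z (x ++ a :: take i v)))
    (a2 := fun i => finishes z (rcons x a ++ take i.+1 v))); last by move=> i; rewrite /= cat_rcons.
  by rewrite -!addnA; congr addn; rewrite addnCA.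
have z0 := wordP z; have sd : size (rdag z) = size z by rewrite size_rdag.
have short_s s : size s < size z -> starts z s = false.
  move=> lt; apply/negP => /orP[]/eqP /(congr1 size); rewrite ?sd size_take_min; move: lt; move: (size s) (size z) => i j; lia.
have short_f s : size s < size z -> finishes z s = false.
  move=> lt; apply/negP => /orP[]/eqP /(congr1 size); rewrite ?sd size_drop; move: lt; move: (size s) (size z) => i j; lia.
have occS : occ w z = count (fun i => starts z (drop i w)) (iota 0 (size w)).
  rewrite occE -addn1 iotaD count_cat /= drop_size -[X in (_ + (nat_of_bool X + _))%N]/(starts z [::]).
  by rewrite short_s ?addn0.
rewrite E -addnn occS; congr addn.
have [lt|le] := ltnP (size w) (size z).
  transitivity 0%N.
    rewrite (eq_in_count (a2 := pred0)) ?count_pred0 // => i _ /=; apply: short_f.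
    by rewrite size_take_min; move: lt; move: (size w) (size z) => a b; lia.
  rewrite (eq_in_count (a2 := pred0)) ?count_pred0 // => i _ /=; apply: short_s.
  by rewrite size_drop; move: lt; move: (size w) (size z) => a b; lia.
(* [N] is the number of possible starting positions, and an occurrence ends [j] letters after its
   start, so the counts of both kinds of marks agree after a shift by [j]. *)
pose N := (size w - size z).+1; pose j := (size z).-1.
have sN : size w = (N + j)%N by rewrite /N /j; move: le z0; move: (size w) (size z) => a b; lia.
set F := fun i => finishes z _; set G := fun i => starts z _.
have -> : count F (iota 0 (size w)) = (count F (iota 0 j) + count F (iota (0 + j) N))%N.
  by rewrite -count_cat -iotaD; congr (count _ (iota _ _)); rewrite sN addnC.
have -> : count G (iota 0 (size w)) = (count G (iota 0 N) + count G (iota (0 + N) j))%N.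
  by rewrite -count_cat -iotaD; congr (count _ (iota _ _)).
rewrite [X in (X + _)%N](_ : _ = 0)%N; last first.
  rewrite (eq_in_count (a2 := pred0)) ?count_pred0 // => i; rewrite mem_iota => /andP[_ li].
  apply: short_f; rewrite size_take_min; move: li z0; rewrite /j; move: (size w) (size z) => a b; lia.
rewrite [X in _ = (_ + X)%N](_ : _ = 0)%N ?addn0; last first.
  rewrite (eq_in_count (a2 := pred0)) ?count_pred0 // => i; rewrite mem_iota => /andP[li _].
  apply: short_s; rewrite size_drop; move: li z0 le; rewrite /N; move: (size w) (size z) => a b; lia.
have -> : iota (0 + j) N = map (addn j) (iota 0 N) by rewrite -iotaDl addn0.
rewrite add0n count_map.
apply: eq_in_count => i; rewrite mem_iota => /andP[_ li] /=.
rewrite /F /G; have -> : (j + i).+1 = (size z + i)%N by rewrite /j; move: z0; move: (size z) => b; lia.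
rewrite /finishes /starts suff_take ?leq_addr //; last first.
  by move: li le; rewrite /N; move: (size w) (size z) => a b; lia.
by rewrite addKn.
Qed.

(** A mark is decided by at most [size z] letters in one direction; hence contexts truncated at
    length [k] suffice for factors of length at most [k]. *)
Lemma marks_congr z x x' w y y' :
  (forall u, take (size z) (u ++ y) = take (size z) (u ++ y')) ->
  (forall u, suff (size z) (x ++ u) = suff (size z) (x' ++ u)) ->
  marks z x w y = marks z x' w y'.
Proof.
move=> hy; elim: w x x' => //= a w IH x x' hx.
rewrite (IH (rcons x a) (rcons x' a)) => [|u]; last by rewrite !cat_rcons hx.
by rewrite /starts /finishes -!cat_cons hy -!cats1 hx.
Qed.
End Marking.

Section Truncation.
Variables (A : invAlphabetType) (k : nat).
Implicit Types x y : seq A.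

Lemma take_takecat j x y : j <= k -> take j (take k x ++ y) = take j (x ++ y).
Proof.
move=> jk; case: (leqP (size x) k) => [le|lt]; first by rewrite (take_oversize le).
have jx : j <= size x by apply: leq_trans jk (ltnW lt).
by rewrite !takel_cat ?size_takel ?(ltnW lt) // take_takel.
Qed.

Lemma take_cattake j x y : j <= k -> take j (x ++ take k y) = take j (x ++ y).
Proof.
move=> jk; rewrite !take_cat; case: ltnP => // le; rewrite take_takel //.
exact: leq_trans (leq_subr _ _) jk.
Qed.

Lemma suff_rdagE j x : suff j x = rdag (take j (rdag x)).
Proof. by rewrite take_rdag !rdagK. Qed.

Lemma rdag_cat x y : rdag (x ++ y) = rdag y ++ rdag x.
Proof. by rewrite /rdag map_cat rev_cat. Qed.

Lemma suff_suffcat j x y : j <= k -> suff j (suff k x ++ y) = suff j (x ++ y).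
Proof.
by move=> jk; rewrite !suff_rdagE !rdag_cat rdagK take_cattake.
Qed.

Lemma suff_catsuff j x y : j <= k -> suff j (x ++ suff k y) = suff j (x ++ y).
Proof.
by move=> jk; rewrite !suff_rdagE !rdag_cat rdagK take_takecat.
Qed.

Definition pre x : k.-bseq A := insub_bseq k (take k x).
Definition suf x : k.-bseq A := insub_bseq k (suff k x).

Lemma val_pre x : pre x = take k x :> seq A.
Proof. by rewrite val_insub_bseq // size_take_min geq_minl. Qed.

Lemma val_suf x : suf x = suff k x :> seq A.
Proof. by rewrite val_insub_bseq // suff_rdagE size_rdag size_take_min geq_minl. Qed.

Lemma vdag_pre x : vdag (pre x) = suf (rdag x).
Proof. by apply: val_inj; rewrite /= val_vdag val_pre val_suf suff_rdag. Qed.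

Lemma vdag_suf x : vdag (suf x) = pre (rdag x).
Proof. by apply: val_inj; rewrite /= val_vdag val_pre val_suf take_rdag. Qed.

Lemma pre_catl x y : pre (pre x ++ y) = pre (x ++ y).
Proof. by apply: val_inj; rewrite /= !val_pre take_takecat. Qed.
Lemma pre_catr x y : pre (x ++ pre y) = pre (x ++ y).
Proof. by apply: val_inj; rewrite /= !val_pre take_cattake. Qed.
Lemma suf_catl x y : suf (suf x ++ y) = suf (x ++ y).
Proof. by apply: val_inj; rewrite /= !val_suf suff_suffcat. Qed.
Lemma suf_catr x y : suf (x ++ suf y) = suf (x ++ y).
Proof. by apply: val_inj; rewrite /= !val_suf suff_catsuff. Qed.
End Truncation.

Section Ends.
Variables (A : invAlphabetType) (k : nat).
Hypothesis k0 : 0 < k.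

(** The empty pair is excluded: it would be an identity, which a nontrivial locally trivial
    semigroup cannot have. The remaining idempotents have both components of full length [k]. *)
Definition ends (_ : 0 < k) : Type :=
  {p : k.-bseq A * k.-bseq A | (0 < size p.1) && (0 < size p.2)}.
Local Notation T := (ends k0).
HB.instance Definition _ := Finite.on T.

Fact ends_subproof (u v : seq A) : (0 < size u) && (0 < size v) ->
  (0 < size (pre k u)) && (0 < size (suf k v)).
Proof. by rewrite val_pre val_suf suff_rdagE size_rdag !size_take_min size_rdag !leq_min k0. Qed.

Definition mk_ends u v (uv : (0 < size u) && (0 < size v)) : T :=
  exist _ (pre k u, suf k v) (ends_subproof uv).

Fact ends_mul_subproof (p q : T) :
  (0 < size ((sval p).1 ++ (sval q).1)) && (0 < size ((sval p).2 ++ (sval q).2)).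
Proof. by have /andP[p1 p2] := svalP p; rewrite !size_cat !addn_gt0 p1 p2. Qed.
Definition ends_mul (p q : T) : T := mk_ends (ends_mul_subproof p q).
Fact ends_mulA : associative ends_mul.
Proof.
move=> p q r; apply: val_inj; congr pair => /=.
  by rewrite pre_catr pre_catl catA.
by rewrite suf_catr suf_catl catA.
Qed.
HB.instance Definition _ := isSemigroup.Build T ends_mulA.

Fact ends_dagger_subproof (p : T) :
  (0 < size (vdag (sval p).2)) && (0 < size (vdag (sval p).1)).
Proof. by have /andP[p1 p2] := svalP p; rewrite !val_vdag !size_rdag p1 p2. Qed.
Definition ends_dagger (p : T) : T := exist _ (vdag (sval p).2, vdag (sval p).1) (ends_dagger_subproof p).
Fact ends_daggerK : involutive ends_dagger.
Proof. by move=> p; apply: val_inj; rewrite /= !vdagK; case: (sval p). Qed.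
HB.instance Definition _ := hasInvolution.Build T ends_daggerK.
Fact ends_daggerM : {morph (@dagger T) : x y / x * y >-> y * x}.
Proof.
move=> p q; apply: val_inj; congr pair => /=.
  by rewrite vdag_suf !val_vdag rdag_cat.
by rewrite vdag_pre !val_vdag rdag_cat.
Qed.
HB.instance Definition _ := Semigroup_isStar.Build T ends_daggerM.

Lemma ends_idempotent (p : T) : p * p = p -> size (sval p).1 = k /\ size (sval p).2 = k.
Proof.
move=> /(congr1 sval); case: p => -[p q] /= /andP[p0 q0] [E1 E2].
have := congr1 (fun x : k.-bseq A => size x) E1; have := congr1 (fun x : k.-bseq A => size x) E2.
rewrite val_pre val_suf suff_rdagE size_rdag !size_take_min size_rdag !size_cat.
by move: p0 q0; move: (size p) (size q) => a b; lia.
Qed.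

Lemma pre_id (x y : seq A) : size x = k -> pre k (x ++ y) = pre k x.
Proof. by move=> sx; apply: val_inj; rewrite /= !val_pre takel_cat ?sx. Qed.

Lemma suf_id (x y : seq A) : size x = k -> suf k (y ++ x) = suf k x.
Proof.
move=> sx; apply: val_inj; rewrite /= !val_suf !suff_rdagE rdag_cat takel_cat //.
by rewrite size_rdag sx.
Qed.

Lemma pre_bseq (x : k.-bseq A) : pre k x = x.
Proof. by apply: val_inj; rewrite /= val_pre take_oversize ?size_bseq. Qed.

Lemma suf_bseq (x : k.-bseq A) : suf k x = x.
Proof. by apply: val_inj; rewrite /= val_suf suff_rdagE take_oversize ?rdagK // size_rdag size_bseq. Qed.

Lemma ends_LI : LI T.
Proof.
move=> p s /ends_idempotent[s1 s2]; apply: val_inj; rewrite /=.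
by rewrite pre_catl -catA pre_id // pre_bseq suf_id // suf_bseq; case: (sval p).
Qed.
End Ends.

Section Counts.
Variables (A : invAlphabetType) (k M : nat).
Hypothesis k0 : 0 < k.
Local Notation B := (k.-bseq A).

Definition counts : Type := {ffun B * B * B -> 'I_M.+1}.
HB.instance Definition _ := Finite.on counts.

Definition clip (i : nat) : 'I_M.+1 := inord (minn M i).
Lemma val_clip i : clip i = minn M i :> nat.
Proof. by rewrite inordK // ltnS geq_minl. Qed.

Definition counts_mul (f g : counts) : counts := [ffun c => clip (f c + g c)].
Fact counts_mulA : associative counts_mul.
Proof. by move=> f g h; apply/ffunP => c; apply: val_inj; rewrite !ffunE /= !val_clip; lia. Qed.
HB.instance Definition _ := isSemigroup.Build counts counts_mulA.

(** The contexts are exchanged and reversed, the factor is kept: [marks] does not distinguish [z]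
    from [rdag z]. *)
Definition counts_dagger (f : counts) : counts :=
  [ffun c : B * B * B => f (vdag c.1.2, vdag c.1.1, c.2)].
Fact counts_daggerK : involutive counts_dagger.
Proof. by move=> f; apply/ffunP => -[[u v] z]; rewrite !ffunE /= !vdagK. Qed.
HB.instance Definition _ := hasInvolution.Build counts counts_daggerK.
Fact counts_daggerM : {morph (@dagger counts) : x y / x * y >-> y * x}.
Proof. by move=> f g; apply/ffunP => c; rewrite !ffunE addnC. Qed.
HB.instance Definition _ := Semigroup_isStar.Build counts counts_daggerM.

Lemma counts_Acom : Acom counts.
Proof.
split; last by move=> f g; apply/ffunP => c; rewrite !ffunE addnC.
exists M => f; apply/ffunP => c; apply: val_inj.
have E n : (spow f n c : nat) = minn M (n.+1 * f c).
  elim: n => [|n IH]; first by rewrite mul1n; apply/esym/minn_idPr; rewrite -ltnS.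
  by rewrite spowS ffunE val_clip IH [in RHS]mulSn; lia.
rewrite [LHS]E [RHS]E; case: (nat_of_ord (f c)) => [|m]; first by rewrite !muln0.
have : M <= M * m.+1 by rewrite leq_pmulr.
by rewrite !mulSn; move: (M * m.+1)%N => q; lia.
Qed.

(** A left factor with ends [t] stands between the left context and the word, so its suffix is
    appended to that context. *)
Definition counts_lact (t : ends A k0) (f : counts) : counts :=
  [ffun c : B * B * B => f (suf k (c.1.1 ++ (sval t).2), c.1.2, c.2)].
Definition counts_ract (f : counts) (t : ends A k0) : counts :=
  [ffun c : B * B * B => f (c.1.1, pre k ((sval t).1 ++ c.1.2), c.2)].

Definition counts_action : lh_action counts (ends A k0).
Proof.
refine (@LHAction counts (ends A k0) counts_lact counts_ract _ _ _ _ _ _ _).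
- by move=> t f g; apply/ffunP => c; rewrite !ffunE.
- by move=> f g t; apply/ffunP => c; rewrite !ffunE.
- by move=> t t' f; apply/ffunP => c; rewrite !ffunE /= suf_catl suf_catr catA.
- by move=> f t t'; apply/ffunP => c; rewrite !ffunE /= pre_catl pre_catr catA.
- by move=> t f t'; apply/ffunP => c; rewrite !ffunE.
- by move=> f t; apply/ffunP => c; rewrite !ffunE /= vdag_suf rdag_cat !val_vdag rdagK.
(* The ends of an idempotent have full length and overwrite both contexts, by the suffix of [e] and
   its image under [vdag]; exchanging and reversing this pair gives it back. *)
move=> e f /ends_idempotent[s1 s2]; apply/ffunP => c; rewrite !ffunE /=.
have sd : size (vdag (sval e).2) = k by rewrite val_vdag size_rdag.
by rewrite suf_id // suf_bseq pre_id // pre_bseq vdagK.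
Defined.

Definition profile (w : word A) : sdprod counts_action :=
  ([ffun c : B * B * B => clip (marks c.2 c.1.1 w c.1.2)],
   mk_ends k0 (introT andP (conj (wordP w) (wordP w)))).

Lemma profile_morphism : star_morphism profile.
Proof.
split=> [u v|u]; congr pair.
- apply/ffunP => -[[x y] z]; apply: val_inj; rewrite !ffunE /= !val_clip marks_cat.
  have -> : marks z x u (pre k (pre k v ++ y)) = marks z x u (v ++ y).
    apply: marks_congr => // s; rewrite pre_catl val_pre take_cattake //; exact: size_bseq.
  have -> : marks z (suf k (x ++ suf k u)) v y = marks z (x ++ u) v y.
    apply: marks_congr => // s; rewrite suf_catr val_suf suff_suffcat //; exact: size_bseq.
  by move: (marks z x u _) (marks z _ v y) => p q; lia.
- by apply: val_inj; congr pair; rewrite /= ?pre_catl ?pre_catr ?suf_catl ?suf_catr.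
- apply/ffunP => -[[x y] z]; apply: val_inj; rewrite !ffunE /= !val_clip !val_vdag.
  by rewrite -[in RHS]marks_rdag !rdagK.
by apply: val_inj; congr pair; rewrite /= ?vdag_suf ?vdag_pre.
Qed.

Lemma profile_approx t (w w' : word A) : M = t.*2 -> profile w = profile w' -> approx t k w w'.
Proof.
move=> Mt [Ec Ep Es].
have tE : take k w = take k w' by have := congr1 val Ep; rewrite /= !val_pre.
have sE : suff k w = suff k w' by have := congr1 val Es; rewrite /= !val_suf.
have st := congr1 size tE; rewrite !size_take_min in st.
case: (ltnP (size w) k) => lt.
  left; split=> //; apply: val_inj => /=.
  by move: tE; rewrite !take_oversize //; move: st lt; move: (size w) (size w') => a b; lia.
have lt' : k <= size w' by move: st lt; move: (size w) (size w') => a b; lia.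
right; split=> //.
- by rewrite -[LHS](take_takel _ (leq_pred k)) tE take_takel ?leq_pred.
- have dE (x : word A) : k <= size x -> drop (size x - k.-1) x = drop 1 (suff k x).
    by move=> le; rewrite /suff drop_drop; congr drop; move: le k0; move: (size x) => a; lia.
  by rewrite !dE // sE.
(* In the empty context there are two marks per occurrence, so the threshold [t] corresponds to the
   cap [t.*2]. *)
move=> v sv; have /ffunP /(_ (pre k [::], pre k [::], pre k v)) := Ec.
rewrite !ffunE /= => /(congr1 val); rewrite /= !val_clip !val_pre take_oversize // !marks_occ Mt.
by rewrite /eq_threshold; lia.
Qed.
End Counts.

Lemma approx_trans (A : invAlphabetType) t k (u v w : word A) :
  approx t k u v -> approx t k v w -> approx t k u w.
Proof.
move=> [[su ->] //|[u1 v1 p1 s1 c1]] [[v2 <-]|[v2 w2 p2 s2 c2]]; first by right.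
right; split=> //; [by rewrite p1 | by rewrite s1 |].
by move=> z sz; have := c1 z sz; have := c2 z sz; rewrite /eq_threshold; lia.
Qed.

(** Equality of profiles refines [approx t k], so a union of classes is the preimage under [profile]
    of its own image. *)
Lemma LRTT_languages_of (A : invAlphabetType) (L : set (word A)) :
  LRTT L -> languages_of (lh_product Acom LI) L.
Proof.
move=> [t [k [t0 k0 [X LE]]]].
exists (sdprod (counts_action A t.*2 k0)).
  move=> V pV; apply; exists (counts A k t.*2), (ends A k0), (counts_action A t.*2 k0).
  by split; [exact: counts_Acom | exact: ends_LI |].
exists (@profile A k t.*2 k0); first exact: profile_morphism.
exists (@profile A k t.*2 k0 @` L); apply/seteqP; split=> w; first by move=> Lw; exists w.
rewrite LE => -[v [u Xu uv] vw]; exists u => //.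
exact: approx_trans uv (profile_approx (erefl _) vw).
Qed.

Lemma LRTT_characterisation (A : invAlphabetType) (L : set (word A)) :
  LRTT L <-> languages_of (lh_product Acom LI) L.
Proof.
split; first exact: LRTT_languages_of.
move=> [S /(_ _ reversible_lt_pseudovariety) VS]; apply: reversible_lt_LRTT; apply: VS.
by move=> _ [S0 [T0 [a [AS LT ->]]]]; apply: reversible_lt_sdprod.
Qed.

Theorem theorem4 :
  involution_variety LRTT /\ corresponds LRTT (lh_product Acom LI).
Proof.
have E : LRTT = languages_of (lh_product Acom LI).
  by apply: functional_extensionality_dep => A; apply/seteqP; split=> L /LRTT_characterisation.
have pV : pseudovariety (lh_product Acom LI) := @pv_generated_pseudovariety _.
rewrite E; split; first exact: languages_of_variety.
split=> // S; split; first exact: pv_of_languages.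
move=> /(_ _ pV); apply=> X [A [L [VL synL]]].
exact: syntactic_in_pseudovariety VL synL.
Qed.
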